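(* For every connected bipartite graph $H$ on at most $5$ vertices and every positive integer $a$, the graph $H^{+a}$ is common. In particular, $K_{2,2,a}$ and $K_{2,3,a}$ are common for every $a\ge 1$.
   Context: For a graph $H$ and a graphon $W$ (a measurable symmetric function $W:[0,1]^2\to[0,1]$), let $t_H(W)=\int_{[0,1]^{V(H)}}\prod_{uv\in E(H)}W(x_u,x_v)\,dx$ and $m_H(W)=t_H(W)+t_H(1-W)$. A graph $H$ is common if $m_H(W)\ge 2^{1-e(H)}$ for every graphon $W$. For a graph $H$ and a positive integer $a$, $H^{+a}$ is the graph obtained from $H$ by adding $a$ new vertices, pairwise non-adjacent, each adjacent to every vertex of $H$. *)

(* Defs.v *)
From HB Require Import structures.
From mathcomp Require Import all_boot all_order all_algebra.
From mathcomp Require Import all_classical all_reals all_analysis.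
Set Implicit Arguments. Unset Strict Implicit. Unset Printing Implicit Defensive.
Import Order.TTheory GRing.Theory Num.Theory.
Local Open Scope classical_set_scope.
Local Open Scope ring_scope.

Definition simple_graph (n : nat) (adj : rel 'I_n) : Prop :=
  symmetric adj /\ irreflexive adj.

Definition graph_connected (n : nat) (adj : rel 'I_n) : Prop :=
  forall i j : 'I_n, connect adj i j.

Definition bipartite (n : nat) (adj : rel 'I_n) : Prop :=
  exists c : 'I_n -> bool, forall i j : 'I_n, adj i j -> c i != c j.

Definition plus_graph (n a : nat) (adj : rel 'I_n) : rel 'I_(n + a) :=
  fun i j =>
    match fintype.split i, fintype.split j with
    | inl i', inl j' => adj i' j'
    | inl _, inr _ => true
    | inr _, inl _ => true
    | inr _, inr _ => false
    end.

(* the edge set: unordered pairs {i,j} encoded as i < j *)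
Definition is_edge (k : nat) (adj : rel 'I_k) (p : 'I_k * 'I_k) : bool :=
  (p.1 < p.2)%N && adj p.1 p.2.

Definition nedges (k : nat) (adj : rel 'I_k) : nat :=
  #|[set p : 'I_k * 'I_k | is_edge adj p]|.

Section Graphons.
Variable R : realType.
Local Open Scope ereal_scope.

Definition is_graphon (W : R -> R -> R) : Prop :=
  measurable_fun (`[0%R, 1%R]%classic `*` `[0%R, 1%R]%classic : set (R * R)) (fun p : R * R => W p.1 p.2)
  /\ (forall x y, x \in `[0%R, 1%R] -> y \in `[0%R, 1%R] -> W x y = W y x)
  /\ (forall x y, x \in `[0%R, 1%R] -> y \in `[0%R, 1%R] ->
                  (0 <= W x y <= 1)%R).

(* Integral over [0,1]^k of f, computed as the iterated Lebesgue integral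
   over the coordinates 0..k-1 (by Tonelli this equals the integral
   w.r.t. the product Lebesgue measure for nonnegative measurable f). *)
Fixpoint cube_integral (k : nat) (f : (nat -> R) -> \bar R) : \bar R :=
  match k with
  | 0 => f (fun _ => 0%R)
  | k'.+1 =>
      \int[@lebesgue_measure R]_(x in `[0%R, 1%R])
        cube_integral k' (fun v => f (fun i => if i == k' then x else v i))
  end.

Definition hom_density (k : nat) (adj : rel 'I_k) (W : R -> R -> R) : \bar R :=
  cube_integral k (fun v =>
    (\prod_(p : 'I_k * 'I_k | is_edge adj p) W (v p.1) (v p.2))%:E).

Definition mono_density (k : nat) (adj : rel 'I_k) (W : R -> R -> R) : \bar R :=
  hom_density adj W + hom_density adj (fun x y => 1 - W x y)%R.

Definition common (k : nat) (adj : rel 'I_k) : Prop :=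
  forall W : R -> R -> R, is_graphon W ->
    ((2 / 2 ^+ nedges adj)%R)%:E <= mono_density adj W.

End Graphons.

(* Main.v *)
(* Write W = (1 + u) / 2 with |u| <= 1. For a vertex map x of H let P_u(x) be the product of
   1 + u over the edges of H, and F_u(x) the average over y of the product of the 1 + u(x_i, y).
   Up to normalisation m_{H^{+a}} is the sum over the two signs of the mean of P_{+-u} F_{+-u}^a.
   Bernoulli's inequality F^a >= 1 + a (F - 1) bounds this sum below by M_H + a (M_{H^{+1}} - M_H),
   where M denotes the same sum for H and for H^{+1}, so it is enough that M_{H^{+1}} >= M_H >= 2.
   For each connected bipartite H on at most 5 vertices, both inequalities follow from explicit
   sums of squares in six vertices, found by semidefinite programming and checked by computation.
   This is carried out for a symmetric matrix over a finite index set; sampling N points of the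
   graphon and letting N tend to infinity gives the analytic statement. *)

(* The graph H^{+1} has at most six vertices, so both inequalities concern polynomials in the 15
   variables u_ij, summed over all maps of six vertices into the index set. Non-injective maps are
   included: once four vertices are fixed as roots, the sums over the other two are exactly
   independent, so a nonnegative function of the root pairs times f(4) f(5) sums to a nonnegative
   multiple of a square, without error terms. The discrepancy between all maps and injective ones
   appears only once, when a graphon is sampled.

   Adding the two signs of u cancels the monomials of odd degree, and relabelling the vertices
   identifies isomorphic monomials; objective and squares are compared modulo these two symmetries.
   The bound |u| <= 1 enters through the multipliers, which are products of factors 1, 1 + u and 1 -
   u over root pairs.

   The inequality M_{H^{+1}} >= M_H says that the slope in a of Bernoulli's bound is nonnegative,
   which is why one pair of certificates for H serves every a. *)
Require Import Defs.
From HB Require Import structures.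
From Stdlib Require Import ZArith.
From mathcomp Require Import all_boot all_order all_algebra.
From mathcomp Require Import all_classical all_reals all_analysis.
From mathcomp Require Import measurable_realfun.
From mathcomp Require Import zify ssrZ ring lra.
Set Implicit Arguments. Unset Strict Implicit. Unset Printing Implicit Defensive.
Import Order.TTheory GRing.Theory Num.Theory.

(** * Sum-of-squares certificates in six vertices *)

(* Colexicographic order, so that [pairs n] is a prefix of [pairs 6]. A monomial in the 15
   variables u_ij is encoded by the bit sequence of its edges in this order. *)
Definition pairs (n : nat) : seq (nat * nat) :=
  flatten [seq [seq (i, j) | i <- iota 0 j] | j <- iota 0 n].

(** Position in colexicographic order: b(b-1)/2 pairs have their larger element below b. *)
Definition pair_index (a b : nat) : nat :=
  if a < b then (b * b.-1)./2 + a else (a * a.-1)./2 + b.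

Section Trie.
Variable A : Type.

(** A finite map keyed by bit sequences, cheap enough for computing with long polynomials. All keys
    of one trie are meant to have the same length, so that leaves occur at one depth only. *)
Inductive trie := Empty | Leaf of A | Node of trie & trie.

Fixpoint update (f : option A -> A) (b : bitseq) (t : trie) : trie :=
  match b with
  | [::] => Leaf (f (if t is Leaf x then Some x else None))
  | c :: b' =>
    let: (l, r) := if t is Node l r then (l, r) else (Empty, Empty) in
    if c then Node l (update f b' r) else Node (update f b' l) r
  end.

Fixpoint lookup (b : bitseq) (t : trie) : option A :=
  match b, t with
  | [::], Leaf x => Some x
  | c :: b', Node l r => lookup b' (if c then r else l)
  | _, _ => None
  end.

Fixpoint elements (t : trie) : seq (A * bitseq) :=
  match t with
  | Empty => [::]
  | Leaf x => [:: (x, [::])]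
  | Node l r => [seq (p.1, false :: p.2) | p <- elements l] ++
                [seq (p.1, true :: p.2) | p <- elements r]
  end.

End Trie.
Arguments Empty {A}.

Definition edge_poly := seq (Z * bitseq).

Definition class_rep (tbl : trie bitseq) (b : bitseq) : bitseq :=
  if lookup b tbl is Some r then r else b.

Definition parity (b : bitseq) : bool := foldr xorb false b.

(* The functionals to be estimated are invariant under relabelling the six vertices and under
   u -> -u: each monomial is replaced by the representative of its orbit, and those of odd
   degree vanish. *)
Definition normalize (tbl : trie bitseq) (p : edge_poly) : edge_poly :=
  elements (foldl (fun t m =>
    if parity m.2 then t
    else update (fun o => Z.add m.1 (if o is Some z then z else Z0)) (class_rep tbl m.2) t)
    Empty p).

Definition scale (k : Z) (p : edge_poly) : edge_poly := [seq (Z.mul k m.1, m.2) | m <- p].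

Fixpoint inserts (x : nat) (s : seq nat) : seq (seq nat) :=
  if s is y :: s' then (x :: s) :: [seq y :: r | r <- inserts x s'] else [:: [:: x]].
Fixpoint perms (s : seq nat) : seq (seq nat) :=
  if s is x :: s' then flatten [seq inserts x r | r <- perms s'] else [:: [::]].

Definition edge_perm (p : seq nat) : seq nat :=
  [seq pair_index (nth 0 p e.1) (nth 0 p e.2) | e <- pairs 6].

Definition relabel (s : seq nat) (b : bitseq) : bitseq := [seq nth false b i | i <- s].

(** Testing each list by computation takes the place of a correctness proof for [perms] and
    [pair_index]. *)
Definition valid_perm (p : seq nat) : bool :=
  let s := edge_perm p in
  [&& size p == 6, uniq p, all (ltn^~ 6) p, uniq s, all (ltn^~ 15) s &
    all (fun ei : (nat * nat) * nat => let: (e, i) := ei in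
           let e' := nth (0, 0) (pairs 6) i in
           (e' == (nth 0 p e.1, nth 0 p e.2)) || (e' == (nth 0 p e.2, nth 0 p e.1)))
        (zip (pairs 6) s)].

Definition perms6 := [seq p <- perms (iota 0 6) | valid_perm p].
Definition edge_perms6 := [seq edge_perm p | p <- perms6].

Definition table (reps : seq bitseq) : trie bitseq :=
  foldl (fun t r => foldl (fun t s => update (fun _ => r) (relabel s r) t) t edge_perms6)
        Empty reps.

Fixpoint bits (n : nat) (z : N) : bitseq :=
  if n is n'.+1 then N.odd z :: bits n' (N.div2 z) else [::].

(* The product of the 1 + eps_e u_e over the pairs e of roots {0, 1, 2, 3}, which is nonnegative
   when all eps_e are in {-1, 0, 1}. *)
Fixpoint multiplier (eps : seq Z) : edge_poly :=
  if eps is e :: eps' then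
    let p := multiplier eps' in
    [seq (m.1, false :: m.2) | m <- p] ++
    (if Z.eqb e Z0 then [::] else [seq (Z.mul e m.1, true :: m.2) | m <- p])
  else [:: (Zpos xH, [::])].

(* The nonempty sets S of roots; S stands for u_S(y), the product of the u_iy over i in S. *)
Definition flags : seq bitseq :=
  [seq bits 4 z | z <- [:: 1; 2; 4; 8; 3; 5; 6; 9; 10; 12; 7; 11; 13; 14; 15]%num].

Definition coef (v : seq Z) (i : nat) : Z := nth Z0 v i.

(* The sum over v of (sum_S v_S u_S(4)) (sum_S v_S u_S(5)), which becomes a sum of squares once
   summed over the vertices 4 and 5. *)
Definition gram (vs : seq (seq Z)) : edge_poly :=
  let idx := iota 0 (foldr (fun v => maxn (size v)) 0 vs) in
  flatten [seq [seq (foldr (fun v z => Z.add (Z.mul (coef v i) (coef v j)) z) Z0 vs,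
      nth [::] flags i ++ nth [::] flags j ++ [:: false]) | j <- idx] | i <- idx].

(** The factors have disjoint variables, those of [p] preceding those of [q], so monomials are
    multiplied by concatenation. *)
Definition pmul (p q : edge_poly) : edge_poly :=
  flatten [seq if Z.eqb a.1 Z0 then [::] else [seq (Z.mul a.1 b.1, b.2 ++ a.2) | b <- p] | a <- q].

(** The signs of one multiplier, together with the vectors of the squares that it multiplies. *)
Definition block := (seq Z * seq (seq Z))%type.

Definition wf_block (B : block) : bool :=
  [&& size B.1 == 6, all (fun e => e \in [:: Z0; Zpos xH; Zneg xH]) B.1 &
      all (fun v : seq Z => size v <= 15) B.2].

Definition squares (B : block) : edge_poly := pmul (multiplier B.1) (gram B.2).

(** The monomial u_S(4) u_S(5), whose sum is a sum of squares of sums over y of u_S(y). For a single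
    root it is the cherry, the path with two edges. *)
Definition cherry_like (s : bitseq) : bitseq := nseq 6 false ++ s ++ s ++ [:: false].

(** One root set of each size from 1 to 4. The four monomials are the members 1088, 3264, 7616 and
    16320 of [class_reps], so a normalized polynomial shows its diagonal terms in this form. *)
Definition diagonals : seq bitseq := [seq cherry_like (nth [::] flags i) | i <- [:: 0; 4; 10; 14]].

(* Rounding leaves an error in the certificates. By AM-GM, twice each error term m u_S u_T is
   compensated by the diagonal terms |m| u_S u_S and |m| u_T u_T. *)
Definition residual (m : Z * bitseq) : edge_poly :=
  if (m.2 \in diagonals) || nth false m.2 14 then [::] else
  let s := take 4 (drop 6 m.2) in let t := take 4 (drop 10 m.2) in
  [:: (Z.mul (Zpos 2) m.1, m.2); (Z.abs m.1, cherry_like s); (Z.abs m.1, cherry_like t)].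

(** The factor [k] matches the scaling of the certificate, and doubling [r] keeps the AM-GM
    compensation integral. What survives in [q] may only be nonnegative multiples of diagonal
    terms. *)
Definition certifies tbl (k : Z) (obj : edge_poly) (cert : seq block) : bool :=
  let r := normalize tbl (scale k obj ++ scale (Zneg xH) (flatten (map squares cert))) in
  let q := normalize tbl (scale (Zpos 2) r ++ scale (Zneg xH) (flatten (map residual r))) in
  all wf_block cert && all (fun m => Z.eqb m.1 Z0 || (Z.leb Z0 m.1 && (m.2 \in diagonals))) q.

(** The monomials in the expansion of the product of the 1 + u_e over the edges e of [b]. *)
Fixpoint submasks (b : bitseq) : seq bitseq :=
  if b is c :: b' then
    let s := submasks b' in
    [seq false :: m | m <- s] ++ (if c then [seq true :: m | m <- s] else [::])
  else [:: [::]].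
Definition ones (p : seq bitseq) : edge_poly := [seq (Zpos xH, m) | m <- p].

Definition graph_mask (n : nat) (h : bitseq) : bitseq := take 15 (h ++ nseq 15 false).
(** The added vertex is n: its pairs with 0, ..., n-1 come right after [pairs n] in colexicographic
    order. *)
Definition cone_mask (n : nat) (h : bitseq) : bitseq :=
  take 15 (h ++ nseq n true ++ nseq 15 false).

Definition dom_poly n h : edge_poly :=
  ones (submasks (cone_mask n h)) ++ scale (Zneg xH) (ones (submasks (graph_mask n h))).
(** The constant is -1 because each of the two signs of u contributes half of the bound M_H >= 2. *)
Definition base_poly n h : edge_poly :=
  ones (submasks (graph_mask n h)) ++ [:: (Zneg xH, nseq 15 false)].

Section Certificates.
Local Open Scope Z_scope.
(* Integers stand for bit sequences, least significant bit first; [class_rep] leaves a monomial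
   outside these orbits unchanged. *)
Definition class_reps : seq N := [:: 0; 63; 1023; 1088; 1091; 1093; 1100; 1103; 1108; 1111; 1118; 1141; 1151; 1152; 1158; 1182; 1185; 1191; 1195; 1197; 1198; 1215; 1217; 1223; 1247; 1260; 1263; 1268; 1271; 1278; 1412; 1415; 1457; 1460; 1463; 1467; 1469; 1532; 1535; 1973; 1983; 3264; 3307; 3309; 3310; 3327; 3395; 3397; 3440; 3443; 3449; 3452; 3455; 3527; 3579; 3582; 3870; 3873; 3879; 3885; 3903; 3948; 3951; 3959; 3966; 4095; 7616; 7619; 7673; 7679; 7902; 7915; 7917; 7935; 8187; 16320; 16350; 16383]%num.
(* Solutions of the semidefinite programs, scaled and rounded to integers: [dom] certifies
   M_{H^{+1}} >= M_H and [base] certifies M_H >= 2. *)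
Definition cert_K2_dom : Z * seq block := (1, [::]).
Definition cert_K2_base : Z * seq block := (1, [::]).
Definition h_K2 := bits 1 1%num.
Definition cert_P3_dom : Z * seq block := (2500, [:: ([:: -1; 0; 0; 0; 0; 0], [:: [:: 37; 75; -1; -1; -33];
   [:: 66; 0; 0; 0; -19];
   [:: 0; 0; -1; 53; -1];
   [:: 0; 0; 53; 0; -1];
   [:: 0; 0; 0; 0; 17];
   [:: 0; 0; 0; 0; 0; 10];
   [:: 0; 0; 0; 0; 0; 0; 10];
   [:: 0; 0; 0; 0; 0; 0; 0; 10];
   [:: 0; 0; 0; 0; 0; 0; 0; 0; 10];
   [:: 0; 0; 0; 0; 0; 0; 0; 0; 0; 10]])]).
Definition cert_P3_base : Z * seq block := (1, [:: ]).
Definition h_P3 := bits 3 5%num.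
Definition cert_P4_dom : Z * seq block := (2500, [:: ([:: -1; -1; 0; 0; 0; 0], [:: [:: 36; -12; 87; 0; -13; -40; -10; 0; 0; 1; 6];
   [:: 41; 86; 0; 0; -42; -18; -12; 0; 0; 0; 6];
   [:: -13; 0; 0; 14];
   [:: 0; 0; 0; 0; -6; 6]]);
  ([:: 1; -1; 0; 0; 0; 0], [:: [:: 9; 19; 70; 0; 2; -7; 9; 0; 0; 0; -7];
   [:: 7; 68; 0; 0; 7; 0; -12; 0; 0; 0; -5];
   [:: 23; 0; 0; -8; 1; -1; 0; 0; 0; 0; -1];
   [:: 0; 0; 0; 0; -4; -4; 14];
   [:: 0; 0; 0; 7]])]).
Definition cert_P4_base : Z * seq block := (1, [:: ]).
Definition h_P4 := bits 6 37%num.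
Definition cert_K13_dom : Z * seq block := (2500, [:: ([:: -1; -1; 0; 0; 0; 0], [:: [:: 110; 26; 26; 0; -33; -33; 9; 1; -1; -1; 21];
   [:: 0; 6; 57; 0; 13; -39; -19; -2; 2; -1; -14];
   [:: 0; 57; 0; 0; -41; 17; -17; -1; -1; 2; -13];
   [:: 0; 0; 0; 14; 7; 7; -7; 0; -1; -1; 1; 0; 0; -2]]);
  ([:: 1; -1; 0; 0; 0; 0], [:: [:: 85; 6; 6; -1; 9; -9; 0; 0; 1; -1; -28];
   [:: 0; 3; -3; 0; 1; 1; 1; 2; 1; 1]])]).
Definition cert_K13_base : Z * seq block := (1, [:: ]).
Definition h_K13 := bits 6 11%num.
Definition cert_C4_dom : Z * seq block := (10000, [:: ([:: -1; -1; -1; 0; 0; 0], [:: [:: 112; 62; 62; -11; -55; -55; -55; 0; 0; 0; 58];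
   [:: 0; 33; 94; -6; -30; -30; -30; 0; 0; 0; 31];
   [:: 0; 87; 0; -4; -20; -20; -20; 0; 0; 0; 22];
   [:: 0; 0; 0; 53; -13; -13; -13; 0; 0; 0; 14]]);
  ([:: 1; -1; -1; 0; 0; 0], [:: [:: 78; 78; 167; -26; -45; -65; -65; 0; 0; 0; 43];
   [:: 148; 24; 0; -15; 22; -41; -3; 0; 0; 0; -9];
   [:: 0; 146; 0; -13; 18; 4; -41; 0; 0; 0; -8];
   [:: 0; 0; 0; 90; -8; -18; -18; 0; 0; 0; 9];
   [:: 0; 0; 0; 0; 78; 21; 21; 0; 0; 0; -55];
   [:: 0; 0; 0; 0; 0; -23; 23]])]).
Definition cert_C4_base : Z * seq block := (4, [:: ([:: 0; 0; 0; 0; 0; 0], [:: [:: 0; 0; 0; 2];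
   [:: 1];
   [:: 0; 1];
   [:: 0; 0; 1]])]).
Definition h_C4 := bits 6 45%num.
Definition cert_P5_dom : Z * seq block := (40000, [:: ([:: -1; -1; -1; -1; 0; 0], [:: [:: 319; 62; 62; 228; -98; -98; -12; -148; -25; -25; 1; 14; 14];
   [:: 0; -72; -72; 78; 13; 13; 18; -11; -3; -3; -2; -1; -1; -1]]);
  ([:: 1; -1; -1; -1; 0; 0], [:: [:: 212; -61; 164; 277; 53; -86; -33; -59; 37; 16; 2; -19; -6];
   [:: -82; 136; -41; 0; -6; 36; -40; 15; -39; 17; -4; -1; -5; 2]]);
  ([:: 1; 1; -1; -1; 0; 0], [:: [:: -44; -8; 212; 40; -10; 45; -28; 14; 27; -9; -4; 8; -2; -1];
   [:: -46; 212; 0; 41; 45; -9; -29; 15; -8; 26; -4; -2; 8; -1];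
   [:: -16; 0; 0; 43; 0; 0; -3; 3; 6; 6; -1; 1; 1; 2]]);
  ([:: -1; -1; 1; -1; 0; 0], [:: [:: -166; 33; 33; 168; -2; -2; -1; -9; 10; 10; -1; -6; -6];
   [:: 0; -130; 130; 0; 75; -75; 0; 0; 19; -19; 0; -3; 3]]);
  ([:: 1; -1; 1; -1; 0; 0], [:: [:: 130; 18; -21; 195; 44; -19; -20; -44; -27; -7; 0; 3; 4; -1];
   [:: 26; 68; -14; 0; 16; -4; -4; -10; -7; -4; 0; -1; 2; -2]]);
  ([:: 1; 1; 1; -1; 0; 0], [:: [:: 204; 36; 36; 103; 35; 35; 10; -35; 6; 6; 0; -6; -6; 1];
   [:: 0; 106; 106; -62; 19; 19; 48; 33; -57; -57; -4; 0; 0; -2]])]).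
Definition cert_P5_base : Z * seq block := (25, [:: ([:: -1; -1; 0; 0; 0; 0], [:: [:: 1; 3; 3; 1];
   [:: 2; 0; 0; 1];
   [:: 0; 0; 0; 2];
   [:: 0; 0; 1]]);
  ([:: 1; -1; 0; 0; 0; 0], [:: [:: 1; -1; 3; 1];
   [:: 2; 3; 0; 1];
   [:: 0; 0; 0; 2];
   [:: 1]])]).
Definition h_P5 := bits 10 549%num.
Definition cert_K14_dom : Z * seq block := (10000, [:: ([:: -1; -1; -1; -1; -1; 0], [:: [:: 80; 127; 12; 12; -74; 3; -15; 3; -15; 1];
   [:: 98; 0; 6; 6; -35; -21; 16; -21; 16];
   [:: 0; 0; -7; 76; 24; 1; 1; -28; -28; 2];
   [:: 0; 0; 76; 0; 27; -28; -28; -2; -2; 2];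
   [:: 0; 0; 0; 0; -5; 26; -16; -17; 14];
   [:: 0; 0; 0; 0; 22; 0; -9; -10; -3; -1];
   [:: 0; 0; 0; 0; 0; 0; -11; -10; 22];
   [:: 0; 0; 0; 0; 0; 0; -8; 14];
   [:: 0; 0; 0; 0; 0; 0; 12];
   [:: 0; 0; 0; 0; 0; 0; 0; 0; 0; 12]]);
  ([:: 1; -1; -1; -1; -1; 0], [:: [:: 19; 55; 11; 11; 20; -1; -10; -1; -10; -1];
   [:: 52; 0; 8; 8; 14; -11; 3; -11; 3];
   [:: 0; 0; -6; 40; -8; 1; 1; -12; -12; 1];
   [:: 0; 0; 40; 0; -9; -12; -12; 0; 0; 1];
   [:: 0; 0; 0; 0; 4; 3; -7; -8; 18; 1];
   [:: 0; 0; 0; 0; 3; 17; -6; -6];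
   [:: 0; 0; 0; 0; 15; 0; 7; 7; 0; 1];
   [:: 0; 0; 0; 0; 0; 0; 13; -6; 0; 1];
   [:: 0; 0; 0; 0; 0; 0; 0; 12; 0; 1];
   [:: 0; 0; 0; 0; 0; 0; 0; 0; 0; 11]]);
  ([:: -1; 1; -1; -1; -1; 0], [:: [:: 51; 57; -5; 108; -5; 2; -1; -37; -49; 1];
   [:: 89; 3; 24; 0; -23; 23; -3; -25; 21; -1];
   [:: 0; 77; 13; 0; -21; 4; -11; 25; -29; 2];
   [:: 0; 0; 60; 0; 10; 22; -16; 3; 0; -1];
   [:: 0; 0; 0; 0; -7; -12; -13; -15; 25; -3];
   [:: 0; 0; 0; 0; 21; 3; -8; -9; 0; 1];
   [:: 0; 0; 0; 0; 0; 20; 9; 9; 0; 2];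
   [:: 0; 0; 0; 0; 0; 0; -7; 14; 0; -1];
   [:: 0; 0; 0; 0; 0; 0; 1; 0; 0; 12];
   [:: 0; 0; 0; 0; 0; 0; 12]]);
  ([:: 1; 1; -1; -1; -1; 0], [:: [:: 10; 88; 38; 15; 19; -4; -35; -1; -15];
   [:: 71; 0; 2; 7; 19; 17; 12; -15; 4; 1];
   [:: 0; 0; 68; -10; -11; 17; -28; 2; 8; -1];
   [:: 0; 0; 0; 51; -8; 2; 4; -13; -18; -2];
   [:: 0; 0; 0; 0; 26; -5; 7; 7; 5; -1];
   [:: 0; 0; 0; 0; 0; 13; 24; 6; -14; -2];
   [:: 0; 0; 0; 0; 0; 10; 0; 20; -8; -1];
   [:: 0; 0; 0; 0; 0; 15; 0; 0; 7];
   [:: 0; 0; 0; 0; 0; 0; 0; 0; 0; 14];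
   [:: 0; 0; 0; 0; 0; 0; 0; 0; 12]]);
  ([:: -1; 1; 1; -1; -1; 0], [:: [:: 86; 45; 4; 29; -34; 9; -1; -23; -6; -1];
   [:: 0; 74; 2; 16; -19; -7; 11; 6; -23; -1];
   [:: 0; 0; -5; 59; 16; -1; -1; -20; -20; -2];
   [:: 0; 0; 44; 0; 9; 14; 14];
   [:: 0; 0; 0; 0; -5; -6; 9; -10; 21];
   [:: 0; 0; 0; 0; 20; 3; 7; -8; 0; -1];
   [:: 0; 0; 0; 0; 0; 19; -8; 9];
   [:: 0; 0; 0; 0; 0; 0; 8; 14; 0; 1];
   [:: 0; 0; 0; 0; 0; 0; 12; 0; 0; -1];
   [:: 0; 0; 0; 0; 0; 0; 0; 0; 0; 11]]);
  ([:: -1; 1; -1; 1; -1; 0], [:: [:: 70; 6; 21; 21; -9; 21; 0; 21];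
   [:: 0; 11; -10; 55; 4; -7; -1; 18; -16; -1];
   [:: 0; 13; 54; 0; 4; 17; -16; -4; -3; -1];
   [:: 0; 44; 0; 0; -10; -5; -9; -5; -9];
   [:: 0; 0; 0; 0; 4; -10; -5; 22; 9; -1];
   [:: 0; 0; 0; 0; 7; 19; 8; 0; -1; -1];
   [:: 0; 0; 0; 0; -5; 0; -7; 0; 17];
   [:: 0; 0; 0; 0; -9; 0; 15; 0; 0; 1];
   [:: 0; 0; 0; 0; 1; 0; 0; 0; 0; 12];
   [:: 0; 0; 0; 0; 11]]);
  ([:: -1; -1; 1; 1; -1; 0], [:: [:: 5; 54; 16; 8; -9; -1; 19; -2; -10];
   [:: 53; 0; 7; 16; -8; -10; -4; 19];
   [:: 0; 0; 45; -6; 5; -11; 16; -2; 3];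
   [:: 0; 0; 0; 45; 6; 2; 0; 15; -11];
   [:: 0; 0; 0; 0; -3; 19; 8; 8; 3];
   [:: 0; 0; 0; 0; -3; 0; 7; 7; 19];
   [:: 0; 0; 0; 0; 17; 0; 8; 8];
   [:: 0; 0; 0; 0; 0; 0; 12; -5; 0; 1];
   [:: 0; 0; 0; 0; 0; 0; 0; 11; 0; 1];
   [:: 0; 0; 0; 0; 0; 0; 0; 0; 0; 11]])]).
Definition cert_K14_base : Z * seq block := (1, [:: ([:: -1; -1; 0; 0; 0; 0], [:: [:: 1]])]).
Definition h_K14 := bits 10 75%num.
Definition cert_fork_dom : Z * seq block := (160000, [:: ([:: -1; -1; -1; -1; 0; 0], [:: [:: 744; 209; 209; 126; -213; -213; -167; -10; -63; -63; 1; 6; 6; 1];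
   [:: 0; 292; 392; -39; -56; -82; -197; 28; 92; 10; 0; -1];
   [:: 0; 262; 0; -15; -59; 7; -75; 11; -88; 127; 0; 0; -1]]);
  ([:: 1; -1; -1; -1; 0; 0], [:: [:: 667; 70; 432; -172; 170; -172; 6; -30; -18; 19; 0; -4; -9];
   [:: 0; 9; 28; -7; 6; -5; 0; 0; -1; 1; 1]]);
  ([:: 1; 1; -1; -1; 0; 0], [:: [:: 547; -36; -36; -20; 56; 56; -16; -40; 86; 86; 0; 5; 5; 1];
   [:: 0; 223; 219; -96; -38; -31; -177; -5; 29; 54; 0; 1; 1; 1];
   [:: 0; 0; 41; 12; 23; -51; -32; -11; 137; -112; 0; 0; 0; 1];
   [:: 0; 0; -11; 82; -49; -29; -56; -39; 0; 66; 1; 0; 0; 2]]);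
  ([:: -1; -1; 1; -1; 0; 0], [:: [:: 156; 57; 57; -148; -12; -12; 12; -7; 5; 5; 2; -1; -1; 6]]);
  ([:: 1; -1; 1; -1; 0; 0], [:: [:: 530; -83; 320; 171; -69; -184; 37; -159; 78; -22; -1; 0; 4; -5];
   [:: 0; 40; 305; 113; -53; -54; 136; -27; -158; -40; 0; -3; 1];
   [:: 0; 227; 0; 41; 172; 171; 163; 54; 41; 94; 1; 2; 0; 1]]);
  ([:: 1; 1; 1; -1; 0; 0], [:: [:: 327; 51; 51; -111; 33; 33; -6; -37; -8; -8; -1; -5; -5; -2];
   [:: 0; -98; 98; 0; -25; 25; 0; 0; 5; -5; 0; 2; -2]])]).
Definition cert_fork_base : Z * seq block := (9, [:: ([:: -1; -1; 0; 0; 0; 0], [:: [:: 1; 2];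
   [:: 1; 0; 2];
   [:: 0; 0; 0; 1];
   [:: 1]]);
  ([:: 1; -1; 0; 0; 0; 0], [:: [:: 1];
   [:: 0; 1; 1; 1];
   [:: 0; 1];
   [:: 0; 0; 1]])]).
Definition h_fork := bits 10 523%num.
Definition cert_C4p_dom : Z * seq block := (40000, [:: ([:: -1; -1; -1; -1; 0; 0], [:: [:: 349; 163; 163; 145; -147; -147; -69; -71; -62; -62; 7; 82; 82; 14];
   [:: 0; -53; 47; 5; 34; -46; -1; 7; 38; -42; 16; -84; 101; 7];
   [:: 0; 5; -26; 15; -32; -8; -5; 25; -19; 5; 52; 56; 0; 24]]);
  ([:: 1; -1; -1; -1; 0; 0], [:: [:: 66; -81; 260; -53; -92; -74; -40; -45; 32; 9; 27; -8; -28; -22];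
   [:: 128; 172; 0; -91; 75; -18; -9; -6; -15; 2; -20; -18; -9; -8]]);
  ([:: 1; 1; -1; -1; 0; 0], [:: [:: 64; 243; -94; 37; 113; -54; 12; -78; 17; -5; 0; -46; -10; 6];
   [:: 96; 0; 225; 55; -11; 100; 18; -118; 1; 16; 0; -30; -54; 9]]);
  ([:: -1; -1; 1; -1; 0; 0], [:: [:: 29; -108; 173; 6; 53; -78; 32; 9; -8; 19; -22; -9; -32; -10];
   [:: -69; 11; 0; 168; -22; -17; -17; -23; -1; -2; 4; -2; -1; 16];
   [:: 66; 135; 0; 0; -56; 7; 68; 21; 19; 6; -46; -49; -38; -21]]);
  ([:: 1; -1; 1; -1; 0; 0], [:: [:: 160; 165; -6; -42; 91; -46; -25; -28; 13; -12; -30; -15; 22; 28];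
   [:: 16; 0; 2; 8; 93; 0; 14; 107; 3; -4; 0; 43; 68; 11]]);
  ([:: 1; 1; 1; -1; 0; 0], [:: [:: 282; 150; 150; -73; 99; 99; 60; -11; -23; -23; 9; -20; -20; -22]])]).
Definition cert_C4p_base : Z * seq block := (16, [:: ([:: -1; 0; 0; 0; 0; 0], [:: [:: 2; 5; 1; 1; 0; 0; -1; 0; -1];
   [:: 4; 0; 1; 1; 0; -1; 0; -1];
   [:: 0; 0; 0; 3];
   [:: 0; 0; 3];
   [:: 0; 0; 0; 0; 0; 0; 1];
   [:: 0; 0; 0; 0; 0; 0; 0; 1];
   [:: 0; 0; 0; 0; 0; 0; 0; 0; 1];
   [:: 0; 0; 0; 0; 0; 1];
   [:: 0; 0; 0; 0; 1];
   [:: 0; 0; 0; 0; 0; 0; 0; 0; 0; 1]])]).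
Definition h_C4p := bits 10 109%num.
Definition cert_K23_dom : Z * seq block := (640000, [:: ([:: -1; -1; -1; -1; -1; 0], [:: [:: 713; 713; 903; 1027; -448; -372; -372; -424; -424; -176; -2; 126; 193; 193];
   [:: 143; -324; 41; 0; -4; -121; 127; -104; 144; -7; 181; 139; 585; -364];
   [:: 169; 208; 487; 0; -114; -194; -215; 11; -10; -44; 253; -249; 0; 80];
   [:: -334; -112; 0; 0; 12; 101; -17; 101; -17; -6; 335; 335; 0; 452]]);
  ([:: 1; -1; -1; -1; -1; 0], [:: [:: 844; -815; 48; 48; 70; -88; 82; -88; 82; 4; -46; -46; 118; -166];
   [:: 0; 220; 364; 364; 531; -10; -33; -10; -33; 31; -346; -346; -198; -161];
   [:: 0; 0; -375; 375; 0; 15; 15; -15; -15; 0; -24; 24]]);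
  ([:: -1; 1; -1; -1; -1; 0], [:: [:: 772; 553; -370; 35; -321; 260; 195; -152; -106; 20; -263; 208; -323; -235];
   [:: 0; -246; -84; -270; -38; -73; 210; 13; 34; -13; 143; 455; 10; 176];
   [:: 0; -88; 135; -40; 61; 436; 95; 77; 143; -10; -328; 0; -386; -31]]);
  ([:: 1; 1; -1; -1; -1; 0], [:: [:: 127; 995; 374; -230; 353; -39; -115; -13; -338; -7; -338; -450; -19; -98];
   [:: -132; 0; 655; 222; -456; 867; -12; 2; -27; -3; -119; 116; -587; -296];
   [:: -64; 0; 85; -45; -37; 0; -10; 6; -15; 6; 27; 14; -13; -85]]);
  ([:: -1; 1; 1; -1; -1; 0], [:: [:: 464; 464; 62; 1096; -268; -53; -53; -592; -592; 69; 18; 148; -408; -408];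
   [:: -124; -124; 818; 0; -33; 133; 133; -23; -23; -10; -19; 290; 92; 92];
   [:: -253; 253; 0; 0; 0; -283; 283; 114; -114; 0; 0; 0; 281; -281]]);
  ([:: -1; 1; -1; 1; -1; 0], [:: [:: -465; 551; 748; 748; 136; -72; -581; -72; -581; -101; 53; 53; 507; 416];
   [:: -534; -354; 0; 0; 633; 48; -21; 48; -21; 37; 18; 18; -291; -374];
   [:: -53; 242; 0; 0; 0; -16; -68; -16; -68; -14; 17; 17; 77; 70]]);
  ([:: -1; -1; 1; 1; -1; 0], [:: [:: 570; -525; -40; 153; 40; -102; -255; 305; 14; 0; -34; -20; -297; 242];
   [:: 0; 223; 297; 258; 194; -203; 181; 67; -227; 1; -132; -134; -80; -190]])]).
Definition cert_K23_base : Z * seq block := (16, [:: ([:: -1; 0; 0; 0; 0; 0], [:: [:: 4; 6; 1; 1; 0; -1; -2; -1; -2];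
   [:: 4; 0; 0; 0; 0; -1; 0; -1];
   [:: 0; 0; 0; 3];
   [:: 0; 0; 3];
   [:: 0; 0; 0; 0; 0; 0; 1];
   [:: 0; 0; 0; 0; 0; 0; 0; 1];
   [:: 0; 0; 0; 0; 0; 0; 0; 0; 1];
   [:: 0; 0; 0; 0; 0; 1];
   [:: 0; 0; 0; 0; 1];
   [:: 0; 0; 0; 0; 0; 0; 0; 0; 0; 1];
   [:: 0; 0; 0; 0; 0; 0; 0; 0; 0; 0; 1];
   [:: 0; 0; 0; 0; 0; 0; 0; 0; 0; 0; 0; 1];
   [:: 0; 0; 0; 0; 0; 0; 0; 0; 0; 0; 0; 0; 0; 1];
   [:: 0; 0; 0; 0; 0; 0; 0; 0; 0; 0; 0; 0; 1]])]).
Definition h_K23 := bits 10 222%num.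
End Certificates.

(** * Classification of the connected bipartite graphs on at most five vertices *)

Definition entry := (nat * bitseq * (Z * seq block) * (Z * seq block))%type.
(** One graph for each isomorphism class. For the graphs on 0 and 1 vertices both objectives reduce
    to zero after normalization, so their certificates are empty. *)
Definition entries : seq entry :=
  [:: (0, [::], (Zpos xH, [::]), (Zpos xH, [::])); (1, [::], (Zpos xH, [::]), (Zpos xH, [::]));
(2, h_K2, cert_K2_dom, cert_K2_base);
  (3, h_P3, cert_P3_dom, cert_P3_base);
  (4, h_P4, cert_P4_dom, cert_P4_base);
  (4, h_K13, cert_K13_dom, cert_K13_base);
  (4, h_C4, cert_C4_dom, cert_C4_base);
  (5, h_P5, cert_P5_dom, cert_P5_base);
  (5, h_K14, cert_K14_dom, cert_K14_base);
  (5, h_fork, cert_fork_dom, cert_fork_base);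
  (5, h_C4p, cert_C4p_dom, cert_C4p_base);
  (5, h_K23, cert_K23_dom, cert_K23_base)].

Definition reps : seq bitseq := [seq bits 15 z | z <- class_reps].

Definition certified_entry tbl (g : entry) : bool :=
  let: (n, h, (k, c), (k', c')) := g in
  [&& Z.ltb Z0 k, Z.ltb Z0 k', certifies tbl k (dom_poly n h) c &
      certifies tbl k' (base_poly n h) c'].

Fixpoint all_bits (n : nat) : seq bitseq :=
  if n is n'.+1 then [seq false :: b | b <- all_bits n'] ++ [seq true :: b | b <- all_bits n']
  else [:: [::]].

Definition crosses (c : bitseq) (e : nat * nat) : bool := nth false c e.1 != nth false c e.2.

(* [||], [&&] and [has] evaluate all their arguments under [vm_compute]; conditionals do not. *)
Fixpoint lazy_has (T : Type) (a : pred T) (s : seq T) : bool :=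
  if s is x :: s' then (if a x then true else lazy_has a s') else false.

Lemma lazy_hasE T (a : pred T) s : lazy_has a s = has a s.
Proof. by elim: s => //= x s ->; case: (a x). Qed.

(** Connectedness by cuts: every non-constant two-colouring of the vertices is crossed by an
    edge. *)
Definition connected_mask (n : nat) (h : bitseq) : bool :=
  all (fun c => if c == nseq n false then true else if c == nseq n true then true else
    lazy_has (fun eb => eb.2 && crosses c eb.1) (zip (pairs n) h)) (all_bits n).

Definition bipartite_mask (n : nat) (h : bitseq) : bool :=
  lazy_has (fun c => all (fun eb => eb.2 ==> crosses c eb.1) (zip (pairs n) h)) (all_bits n).

(** One relabelling of the six vertices has to carry both the graph and its cone. Edge counts are
    compared before the relabellings are searched. *)
Definition covered (es : seq (seq nat)) (n : nat) (h : bitseq) : bool :=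
  lazy_has (fun g : entry => let h0 := g.1.1.2 in
    if g.1.1.1 != n then false else if count id h0 != count id h then false else
      lazy_has (fun s => if relabel s (graph_mask n h0) == graph_mask n h
                         then relabel s (cone_mask n h0) == cone_mask n h else false) es) entries.

Definition classification (es : seq (seq nat)) : bool :=
  all (fun n => all (fun h => if bipartite_mask n h then
      if connected_mask n h then covered es n h else true else true)
    (all_bits (size (pairs n)))) (iota 0 6).

(** The [let] has the table of orbits computed once and shared by all entries. *)
Lemma entries_certified : all (fun r : bitseq => size r == 15) reps &&
  let tbl := table reps in all (certified_entry tbl) entries.
Proof. by vm_cast_no_check (erefl true). Qed.

Lemma classification_holds : let es := edge_perms6 in classification es.
Proof. by vm_cast_no_check (erefl true). Qed.

Local Open Scope ring_scope.
Arguments pairs : simpl never.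
Arguments edge_perm : simpl never.

(** * Soundness of the certificates *)

Section IntegerCasts.
Variable R : realFieldType.
Definition zr (z : Z) : R := (int_of_Z z)%:~R.
Lemma zrD a b : zr (Z.add a b) = zr a + zr b.
Proof. by rewrite /zr -intrD -(rmorphD int_of_Z). Qed.
Lemma zrM a b : zr (Z.mul a b) = zr a * zr b.
Proof. by rewrite /zr -intrM -(rmorphM int_of_Z). Qed.
Lemma zr0 : zr Z0 = 0. Proof. by []. Qed.
Lemma zr1 : zr (Zpos xH) = 1. Proof. by []. Qed.
Lemma zrN1 : zr (Zneg xH) = -1. Proof. by []. Qed.
Lemma zr2 : zr (Zpos 2) = 2%:R. Proof. by []. Qed.
Lemma zr_ge0 z : Z.leb Z0 z -> 0 <= zr z.
Proof. by case: z => [|p|p] //= _; rewrite /zr ler0z; lia. Qed.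
Lemma zr_gt0 z : Z.ltb Z0 z -> 0 < zr z.
Proof. by case: z => [|p|p] //= _; rewrite /zr ltr0z; lia. Qed.
Lemma zr_abs z : zr (Z.abs z) = `|zr z|.
Proof.
rewrite /zr -intr_norm; congr (_%:~R).
by case: z => [|p|p] //=; lia.
Qed.
End IntegerCasts.

(** * Linear functionals on polynomials in the edge variables *)

Section Linear.
Variable R : realFieldType.
Variable T : bitseq -> R.

Definition lin (T : bitseq -> R) (p : edge_poly) : R := \sum_(m <- p) zr R m.1 * T m.2.

Lemma lin_cat T' p q : lin T' (p ++ q) = lin T' p + lin T' q.
Proof. by rewrite /lin big_cat. Qed.

Lemma lin_scale T' k p : lin T' (scale k p) = zr R k * lin T' p.
Proof.
rewrite /lin /scale big_map mulr_sumr; apply: eq_bigr => m _ /=.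
by rewrite zrM mulrA.
Qed.

Lemma lin_flatten T' ps : lin T' (flatten ps) = \sum_(p <- ps) lin T' p.
Proof.
elim: ps => [|p ps IH]; first by rewrite /lin !big_nil.
by rewrite /= lin_cat IH big_cons.
Qed.

Fixpoint trie_depth A (n : nat) (t : trie A) : Prop :=
  match n, t with
  | _, Empty => True
  | 0, Leaf _ => True
  | n'.+1, Node l r => trie_depth n' l /\ trie_depth n' r
  | _, _ => False
  end.

(** The functional is generalized for the induction: descending into a branch [c] replaces it by
    [fun m => T' (c :: m)]. *)
Lemma lin_elements_update T' n b z (t : trie Z) : trie_depth n t -> size b = n ->
  let t' := update (fun o => Z.add z (if o is Some y then y else Z0)) b t in
  trie_depth n t' /\ lin T' (elements t') = lin T' (elements t) + zr R z * T' b.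
Proof.
elim: n b t T' => [|n IH] [|c b] t T' //=.
  case: t => [|x|l r] //= _ _; split=> //; rewrite /lin !(big_nil, big_cons) /= ?addr0 zrD ?zr0.
    by rewrite addr0 add0r.
  by rewrite mulrDl addrC.
have lin_map d p : lin T' [seq (q.1, d :: q.2) | q <- p] = lin (fun m => T' (d :: m)) p.
  by rewrite /lin big_map.
move=> dt [sb].
have [l [r [-> [dl dr] ->]]] : exists l, exists r, [/\ (if t is Node l r then (l, r) else (Empty, Empty)) = (l, r),
    trie_depth n l /\ trie_depth n r &
    lin T' (elements t) = lin T' (elements (Node l r))].
  case: t dt => [|x|l r] //= dt; first by exists Empty, Empty; do !split; rewrite //; case: n {IH sb dt}.
  by exists l, r.
case: c => /=; rewrite !lin_cat !lin_map.
  by have [? ->] := IH b r (fun m => T' (true :: m)) dr sb; split=> //; rewrite addrA.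
by have [? ->] := IH b l (fun m => T' (false :: m)) dl sb; split=> //; rewrite addrAC.
Qed.

Variable tbl : trie bitseq.
Hypothesis canonT : forall b, size b = 15 -> T (class_rep tbl b) = T b /\ size (class_rep tbl b) = 15.
Hypothesis oddT : forall b, size b = 15 -> parity b -> T b = 0.

Lemma size_elements n (t : trie Z) : trie_depth n t ->
  all (fun m => size m.2 == n) (elements t).
Proof.
elim: n t => [|n IH] [|x|l r] //= [dl dr].
by rewrite all_cat !all_map; apply/andP; split; [apply: (IH l) | apply: (IH r)].
Qed.

Lemma lin_normalize p : all (fun m => size m.2 == 15) p ->
  all (fun m => size m.2 == 15) (normalize tbl p) /\
  lin T (normalize tbl p) = lin T p.
Proof.
(* The fold is generalized over its accumulator, which holds the monomials already read and starts
   with value 0. *)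
rewrite /normalize -[X in _ /\ _ = X]add0r.
have -> : 0 = lin T (elements Empty) by rewrite /lin /= big_nil.
have : trie_depth 15 (@Empty Z) by [].
elim: p Empty => [|[z b] p IH] t dt /=.
  by move=> _; split; [exact: size_elements | rewrite [lin T [::]]/lin big_nil addr0].
case/andP=> /eqP sb sp; rewrite [lin T (_ :: _)]/lin big_cons -/(lin T p) /=.
have [pb|pb] := boolP (parity b); first by rewrite oddT // mulr0 add0r; apply: IH.
have [Tb sc] := canonT sb.
have [dt' E] := lin_elements_update T z dt sc.
by rewrite addrA -Tb -E; apply: IH.
Qed.

End Linear.

Section TableEntries.
Variable A : Type.

Fixpoint trie_all (P : bitseq -> A -> Prop) (t : trie A) : Prop :=
  match t with
  | Empty => True
  | Leaf x => P [::] x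
  | Node l r => trie_all (fun b => P (false :: b)) l /\ trie_all (fun b => P (true :: b)) r
  end.

Lemma trie_all_update P b x t : trie_all P t -> P b x -> trie_all P (update (fun _ => x) b t).
Proof.
elim: b P t => [|c b IH] P t //= Pt Px.
have [l [r [-> Pl Pr]]] : exists l, exists r, [/\ (if t is Node l r then (l, r) else (Empty, Empty)) = (l, r),
    trie_all (fun b => P (false :: b)) l & trie_all (fun b => P (true :: b)) r].
  by case: t Pt => [|y|l r] /=; [exists Empty, Empty | exists Empty, Empty | case; exists l, r].
case: c Px => Px /=; split=> //; first exact: (IH (fun b => P (true :: b))).
exact: (IH (fun b => P (false :: b))).
Qed.

Lemma trie_all_lookup P b x t : trie_all P t -> lookup b t = Some x -> P b x.
Proof.
elim: b P t => [|c b IH] P [|y|l r] //=; first by move=> ? [<-].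
case=> Pl Pr; case: c.
  exact: (IH (fun b => P (true :: b))).
exact: (IH (fun b => P (false :: b))).
Qed.

End TableEntries.

Section Monomials.
Variables (R : comRingType) (f : R -> R).

(** With [f] the identity this is a monomial in the edge variables; with [f] equal to [+%R 1] it is
    the product of the 1 + u over the edges of a graph. *)
Fixpoint mono (b : bitseq) (xs : seq R) : R :=
  match b, xs with
  | c :: b', x :: xs' => (if c then f x else 1) * mono b' xs'
  | _, _ => 1
  end.

Lemma mono_nth n b xs : size b = n -> size xs = n ->
  mono b xs = \prod_(i <- iota 0 n) (if nth false b i then f (nth 0 xs i) else 1).
Proof.
elim: n b xs => [|n IH] [|c b] [|x xs] //=; first by rewrite big_nil.
move=> [sb] [sx]; rewrite big_cons /= (IH _ _ sb sx) -[1%N]addn0 iotaDl big_map.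
by congr (_ * _).
Qed.

Lemma mono_relabel n s b xs : size b = n -> size xs = n -> perm_eq s (iota 0 n) ->
  mono (relabel s b) [seq nth 0 xs i | i <- s] = mono b xs.
Proof.
move=> sb sx ps; have ss : size s = n by rewrite (perm_size ps) size_iota.
rewrite (mono_nth sb sx) -(perm_big _ ps) /=.
have {n sb sx ps ss} : all (fun i => true) s by apply/allP.
by elim: s => [|i s IH] /=; rewrite ?big_nil ?big_cons // => /IH ->.
Qed.

Lemma mono_cat b1 b2 x1 x2 : size b1 = size x1 ->
  mono (b1 ++ b2) (x1 ++ x2) = mono b1 x1 * mono b2 x2.
Proof.
by elim: b1 x1 => [|c b1 IH] [|x x1] //= => [_|[/IH ->]]; rewrite ?mul1r ?mulrA.
Qed.

Lemma mono_nseqF n xs : mono (nseq n false) xs = 1.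
Proof. by elim: n xs => [|n IH] [|x xs] //=; rewrite IH mulr1. Qed.
End Monomials.

Lemma mono_opp (R : comRingType) b (xs : seq R) : (size b <= size xs)%N ->
  mono id b [seq - x | x <- xs] = (-1) ^+ parity b * mono id b xs.
Proof.
elim: b xs => [|c b IH] [|x xs] //=; try by rewrite mulr1.
rewrite ltnS => /IH ->; case: c => /=; last by rewrite !mul1r.
by case: (parity b); rewrite ?expr0 ?expr1 /=; ring.
Qed.

(** * Sums over vertex maps and their invariance under relabelling *)

Section EnvSums.
Variables (R : realFieldType) (I : finType) (i0 : I).
Implicit Types (G : (nat -> I) -> R) (v : nat -> I).

(** Maps are extended by [i0] to all natural numbers, so that one function of the vertices can be
    summed over different numbers of vertices. *)
Definition env k (phi : {ffun 'I_k -> I}) (j : nat) : I :=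
  if insub j is Some i then phi i else i0.
Definition esum k G : R := \sum_(phi : {ffun 'I_k -> I}) G (env phi).
Definition upd v k y := fun i : nat => if i == k then y else v i : I.

Lemma env_ord k (phi : {ffun 'I_k -> I}) (i : 'I_k) : env phi i = phi i.
Proof. by rewrite /env valK. Qed.

Lemma esum_ext k G G' : (forall v, G v = G' v) -> esum k G = esum k G'.
Proof. by move=> E; apply: eq_bigr. Qed.

Lemma esumD k G G' : esum k (fun v => G v + G' v) = esum k G + esum k G'.
Proof. exact: big_split. Qed.

Lemma esumZ k c G : esum k (fun v => c * G v) = c * esum k G.
Proof. by rewrite /esum mulr_sumr. Qed.

Lemma esum_sum k J (r : seq J) (F : J -> (nat -> I) -> R) :
  esum k (fun v => \sum_(j <- r) F j v) = \sum_(j <- r) esum k (F j).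
Proof. exact: exchange_big. Qed.

Lemma esum_ge0 k G : (forall v, 0 <= G v) -> 0 <= esum k G.
Proof. by move=> G0; apply: sumr_ge0. Qed.

Lemma ler_esum k G G' : (forall v, G v <= G' v) -> esum k G <= esum k G'.
Proof. by move=> G0; apply: ler_sum. Qed.

Lemma esum_const k c : esum k (fun _ => c) = #|I|%:R ^+ k * c.
Proof.
by rewrite /esum big_const iter_addr_0 card_ffun card_ord -[c *+ _]mulr_natr natrX mulrC.
Qed.

Lemma esumS k G : esum k.+1 G = esum k (fun v => \sum_y G (upd v k y)).
Proof.
rewrite /esum pair_big /=.
pose h (p : {ffun 'I_k -> I} * I) : {ffun 'I_k.+1 -> I} :=
  [ffun i => if unlift ord_max i is Some j then p.1 j else p.2].
rewrite (reindex h) /=; last first.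
  apply: onW_bij; exists (fun phi : {ffun 'I_k.+1 -> I} => ([ffun j => phi (lift ord_max j)], phi ord_max)).
    move=> [psi y]; rewrite /h /= ffunE unlift_none; congr (_, _).
    by apply/ffunP=> j; rewrite !ffunE liftK.
  move=> phi; apply/ffunP=> i; rewrite ffunE.
  by case: unliftP => [j ->|->] /=; rewrite ?ffunE.
apply: eq_bigr => -[psi y] _ /=; congr (G _); apply/funext=> j.
rewrite /upd /env /h; case: eqP => [->|/eqP jk].
  rewrite insubT /= => [|ltk]; first exact: ltnSn.
  rewrite ffunE; set i := (X in unlift _ X).
  by have -> : i = ord_max by [apply: val_inj]; rewrite unlift_none.
case: insubP => [i /= _ ij|/=]; case: insubP => [i' /= ltj ij'|/=] //.
- rewrite ffunE (_ : i = lift ord_max i') ?liftK //.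
  by apply: val_inj; rewrite /= /bump leqNgt ij' ltj add0n ij -ij'.
- by move/negbTE; have := ltn_ord i; rewrite ij ltnS leq_eqVlt (negbTE jk) /= => ->.
- by rewrite ltnS leq_eqVlt (negbTE jk) /= ltj.
Qed.

Definition values (u : I -> I -> R) v : seq R := [seq u (v e.1) (v e.2) | e <- pairs 6].

Lemma size_values u v : size (values u v) = 15.
Proof. by rewrite size_map. Qed.

(** Composing the vertex maps with [p] permutes the fifteen values; symmetry of [u] enters where [p]
    reverses a pair. *)
Lemma esum_relabel (u : I -> I -> R) (H : seq R -> R) p :
  (forall x y, u x y = u y x) -> valid_perm p ->
  esum 6 (fun v => H (values u v)) =
  esum 6 (fun v => H [seq nth 0 (values u v) i | i <- edge_perm p]).
Proof.
rewrite /valid_perm => usym /andP[/eqP sp] /andP[up] /andP[allp] /andP[_] /andP[/allP lts /allP okp].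
pose pi (i : 'I_6) : 'I_6 := inord (nth 0 p i).
have pi_val (i : 'I_6) : pi i = nth 0 p i :> nat.
  by rewrite inordK //; apply: (allP allp); rewrite mem_nth // sp.
have pi_inj : injective pi.
  move=> i j /(congr1 val); rewrite /= !pi_val => /eqP.
  by rewrite nth_uniq ?sp // => /eqP /val_inj.
rewrite {1}/esum (reindex (fun phi : {ffun 'I_6 -> I} => [ffun i => phi (pi i)])); last first.
  have [g piK gK] := injF_bij pi_inj.
  apply: onW_bij; exists (fun phi : {ffun 'I_6 -> I} => [ffun i => phi (g i)]) => phi;
    by apply/ffunP=> i; rewrite !ffunE ?gK ?piK.
apply: eq_bigr => phi _; congr (H _).
have envp j : (j < 6)%N -> env [ffun i => phi (pi i)] j = env phi (nth 0 p j).
  by move=> lt_j; rewrite -[j]/(val (Ordinal lt_j)) env_ord ffunE -pi_val env_ord.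
apply: (@eq_from_nth _ 0) => [|i]; first by rewrite !size_map.
rewrite size_values => lti; rewrite [RHS](nth_map 0%N); last by rewrite size_map.
set e := nth (0%N, 0%N) (pairs 6) i.
have [e1 e2] : (e.1 < 6)%N /\ (e.2 < 6)%N.
  by apply/andP; have : all (fun e => (e.1 < 6)%N && (e.2 < 6)%N) (pairs 6) by []; move/allP; apply; apply: mem_nth.
rewrite (nth_map (0%N, 0%N)) // -/e envp // envp //.
set k := nth _ (edge_perm p) i.
have /okp : (e, k) \in zip (pairs 6) (edge_perm p).
  by rewrite /e /k -nth_zip ?size_map // mem_nth // size_zip size_map.
have ltk : (k < 15)%N by apply: lts; rewrite mem_nth // size_map.
rewrite [nth 0 (values u _) k](nth_map (0%N, 0%N)) //.
by case/orP => /eqP -> //=; rewrite usym.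
Qed.
End EnvSums.

Arguments Z.mul : simpl never.
Arguments Z.add : simpl never.
Arguments Z.abs : simpl never.

Section PolyEval.
Variable R : realFieldType.
Implicit Types (xs : seq R) (p q : edge_poly).

Definition peval xs p : R := \sum_(m <- p) zr R m.1 * mono id m.2 xs.

Lemma peval_pmul x1 x2 p q : all (fun m => size m.2 == size x1) p ->
  peval (x1 ++ x2) (pmul p q) = peval x1 p * peval x2 q.
Proof.
move=> sp; rewrite /peval /pmul big_flatten big_map mulr_sumr.
apply: eq_bigr => -[z b] _ /=; case: Z.eqb_spec => [->|_].
  by rewrite big_nil zr0 mul0r mulr0.
rewrite big_map mulr_suml; apply: eq_big_seq => -[y c] /(allP sp) /eqP /= sc.
by rewrite mono_cat // zrM; ring.
Qed.

Lemma size_multiplier eps : all (fun m => size m.2 == size eps) (multiplier eps).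
Proof.
elim: eps => //= e eps IH; rewrite all_cat all_map IH /=.
by case: Z.eqb_spec => //= _; rewrite all_map.
Qed.

Lemma peval_multiplier eps xs : size eps = size xs ->
  peval xs (multiplier eps) = \prod_(ex <- zip eps xs) (1 + zr R ex.1 * ex.2).
Proof.
elim: eps xs => [|e eps IH] [|x xs] //=; first by rewrite /peval !big_seq1 big_nil mulr1.
move=> [/IH {}IH]; rewrite big_cons -IH /= /peval big_cat big_map /=.
under eq_bigr do rewrite mul1r.
rewrite mulrDl mul1r; congr (_ + _).
case: Z.eqb_spec => [->|_]; first by rewrite big_nil zr0 !mul0r.
rewrite big_map mulr_sumr; apply: eq_bigr => -[z b] _ /=.
by rewrite zrM; ring.
Qed.

Lemma multiplier_ge0 eps xs : all (fun e => e \in [:: Z0; Zpos xH; Zneg xH]) eps ->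
  all (fun x => `|x| <= 1) xs -> 0 <= \prod_(ex <- zip eps xs) (1 + zr R ex.1 * ex.2).
Proof.
elim: eps xs => [|e eps IH] [|x xs] //=; rewrite ?big_nil //.
move=> /andP[he /IH{}IH] /andP[hx /IH{}IH]; rewrite big_cons mulr_ge0 //=.
move: hx; rewrite ler_norml => /andP[? ?].
by move: he; rewrite !inE => /or3P[] /eqP ->; rewrite ?zr0 ?zr1 ?zrN1; lra.
Qed.

Lemma size_flag i : (i < 15)%N -> size (nth [::] flags i) = 4%N.
Proof.
have /allP H : all (fun i => size (nth [::] flags i) == 4%N) (iota 0 15) by [].
by move=> lti; apply/eqP; apply: H; rewrite mem_iota.
Qed.

Definition gram_size (vs : seq (seq Z)) : nat := foldr (fun v => maxn (size v)) 0 vs.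

Lemma gram_size_le vs : all (fun v : seq Z => (size v <= 15)%N) vs -> (gram_size vs <= 15)%N.
Proof. by elim: vs => //= v vs IH /andP[sv /IH]; rewrite geq_max sv. Qed.

Definition form (v : seq Z) n (A : nat -> R) : R := \sum_(i <- iota 0 n) zr R (coef v i) * A i.

(** A Gram matrix is a sum of rank-one matrices: each [v] yields the same linear form in the flags
    at vertex 4 and in those at vertex 5. Here [z] is the value at the pair (4, 5). *)
Lemma peval_gram vs s t z : (gram_size vs <= 15)%N -> size s = 4%N -> size t = 4%N ->
  peval (s ++ t ++ [:: z]) (gram vs) =
  \sum_(v <- vs) form v (gram_size vs) (fun i => mono id (nth [::] flags i) s) *
                 form v (gram_size vs) (fun i => mono id (nth [::] flags i) t).
Proof.
rewrite /gram -/(gram_size vs) => le15 ss st; set n := gram_size vs in le15 *.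
rewrite /peval big_flatten big_map.
under [RHS]eq_bigr do rewrite /form mulr_suml.
rewrite exchange_big /=; apply: eq_big_seq => i; rewrite mem_iota => /= lti.
rewrite big_map; under [RHS]eq_bigr do rewrite mulr_sumr.
rewrite exchange_big /=; apply: eq_big_seq => j; rewrite mem_iota => /= ltj.
rewrite mono_cat ?size_flag ?ss //; last exact: leq_trans lti le15.
rewrite mono_cat ?size_flag ?st //; last exact: leq_trans ltj le15.
rewrite /= mul1r mulr1.
rewrite (_ : zr R _ = \sum_(v <- vs) zr R (coef v i) * zr R (coef v j)).
  by rewrite mulr_suml; apply: eq_bigr => v _; ring.
by elim: (vs) => [|v vs' IH] /=; rewrite ?big_nil ?big_cons ?zr0 // zrD zrM IH.
Qed.

Lemma size_gram vs : (gram_size vs <= 15)%N -> all (fun m => size m.2 == 9%N) (gram vs).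
Proof.
rewrite /gram -/(gram_size vs) => le15; apply/allP=> m /flattenP[_ /mapP[i Hi ->]] /mapP[j Hj ->] /=.
move: Hi Hj; rewrite !mem_iota /= !add0n => /leq_trans/(_ le15) Hi /leq_trans/(_ le15) Hj.
by rewrite !size_cat !size_flag.
Qed.

Lemma size_squares B : wf_block B -> all (fun m => size m.2 == 15%N) (squares B).
Proof.
case/and3P=> /eqP se _ /gram_size_le sv; apply/allP=> m /flattenP[_ /mapP[a Ha ->]].
case: Z.eqb_spec => //= _ /mapP[b Hb ->] /=.
have := allP (size_multiplier B.1) _ Hb; have := allP (size_gram sv) _ Ha.
by rewrite size_cat se => /eqP -> /eqP ->.
Qed.

End PolyEval.

(** * Nonnegativity of the squares and of the compensated errors *)

Section Positivity.
Variables (R : realFieldType) (I : finType) (i0 : I) (u : I -> I -> R).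
Hypothesis u_le1 : forall x y, `|u x y| <= 1.
Let T b := esum i0 6 (fun v => mono id b (values u v)).

Lemma lin_esum p : lin T p = esum i0 6 (fun v => peval (values u v) p).
Proof.
by rewrite /peval esum_sum; apply: eq_bigr => m _; rewrite /T esumZ.
Qed.

Definition roots (v : nat -> I) := [seq u (v e.1) (v e.2) | e <- pairs 4].
Definition spokes (v : nat -> I) y := [seq u (v i) y | i <- iota 0 4].

(** The order of [pairs 6] is made for this: root pairs, spokes at 4, spokes at 5, and the pair (4,
    5) last. *)
Lemma esum_roots (G : seq R -> R) : esum i0 6 (fun v => G (values u v)) =
  esum i0 4 (fun v => \sum_y \sum_y' G (roots v ++ spokes v y ++ spokes v y' ++ [:: u y y'])).
Proof. by rewrite !esumS. Qed.

(** For fixed roots the multiplier is a nonnegative constant, and summing over the vertices 4 and 5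
    independently turns each product of forms into a square. *)
Lemma squares_ge0 B : wf_block B -> 0 <= lin T (squares B).
Proof.
case/and3P=> /eqP se he /gram_size_le sv.
rewrite lin_esum (esum_roots (fun xs => peval xs (squares B))).
apply: esum_ge0 => v.
have sr : size (roots v) = 6%N by [].
under eq_bigr => y _.
  under eq_bigr => y' _.
    rewrite peval_pmul; last by rewrite sr -se size_multiplier.
    rewrite peval_gram //.
  over.
  rewrite -mulr_sumr exchange_big /=.
over.
rewrite -mulr_sumr exchange_big /= mulr_ge0 //.
  rewrite peval_multiplier ?se //; apply: multiplier_ge0 => //.
  by apply/allP=> _ /mapP[e _ ->].
apply: sumr_ge0 => w _.
under eq_bigr do rewrite -mulr_sumr.
by rewrite -mulr_suml -expr2 sqr_ge0.
Qed.

Lemma mono_le1 b xs : all (fun x => `|x| <= 1) xs -> `|mono id b xs| <= 1 :> R.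
Proof.
elim: b xs => [|c b IH] [|x xs] //=; rewrite ?normr1 // => /andP[hx /IH h].
rewrite normrM mulr_ile1 //; by case: c; rewrite ?normr1.
Qed.

Lemma T_split m0 s t : size m0 = 6%N -> size s = 4%N -> size t = 4%N ->
  T (m0 ++ s ++ t ++ [:: false]) =
  esum i0 4 (fun v => mono id m0 (roots v) *
    ((\sum_y mono id s (spokes v y)) * (\sum_y mono id t (spokes v y)))).
Proof.
move=> s0 s1 s2; rewrite /T (esum_roots (mono id _)); apply: esum_ext => v.
under eq_bigr => y _.
  under eq_bigr => y' _ do rewrite mono_cat // mono_cat // mono_cat //= mulr1 mulr1.
  rewrite -mulr_sumr -mulr_sumr.
over.
by rewrite -mulr_sumr -mulr_suml.
Qed.

Lemma cherry_like_ge0 s : size s = 4%N -> 0 <= T (cherry_like s).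
Proof.
move=> ss; rewrite /cherry_like T_split //; apply: esum_ge0 => v.
by rewrite mono_nseqF mul1r -expr2 sqr_ge0.
Qed.

(** For fixed roots let A and B be the sums over y of u_S and u_T, and M the root part of the
    monomial. The claim is 2 r M A B + |r| (A^2 + B^2) >= 0, which holds since |M| <= 1. *)
Lemma residual_ge0 m : size m.2 = 15%N -> 0 <= lin T (residual m).
Proof.
case: m => r b /= sb; rewrite /residual /=; case: ifP => [_|/norP[_ hb]].
  by rewrite /lin big_nil.
set s := take 4 (drop 6 b); set t := take 4 (drop 10 b).
have [s0 ss st] : [/\ size (take 6 b) = 6%N, size s = 4%N & size t = 4%N].
  by rewrite !size_take !size_drop sb.
have Eb : b = take 6 b ++ s ++ t ++ [:: false].
  rewrite -[LHS](cat_take_drop 6 b); congr (_ ++ _).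
  rewrite -[LHS](cat_take_drop 4 (drop 6 b)) drop_drop; congr (_ ++ _).
  rewrite -[LHS](cat_take_drop 4 (drop _ b)) drop_drop; congr (_ ++ _).
  by rewrite (drop_nth false) ?sb // (negbTE hb) drop_oversize ?sb.
rewrite /lin !big_cons big_nil addr0 /= {1}Eb /cherry_like !T_split //.
rewrite -!esumZ -!esumD; apply: esum_ge0 => v.
rewrite !mono_nseqF !mul1r zrM zr2 zr_abs.
set A := \sum_y mono id s _; set B := \sum_y mono id t _.
have : `|mono id (take 6 b) (roots v)| <= 1.
  by apply: mono_le1; apply/allP=> _ /mapP[e _ ->].
set M := mono id _ _ => hM.
have : - (`|zr R r| * (`|A| * `|B|)) <= zr R r * (M * (A * B)).
  apply: le_trans (_ : - `|zr R r * (M * (A * B))| <= _); last by rewrite lerNnormlW.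
  rewrite lerN2 !normrM ler_wpM2l // -[leRHS]mul1r ler_wpM2r // mulr_ge0 //.
have : `|A| * `|B| *+ 2 <= A * A + B * B.
  have nn (x : R) : x * x = `|x| * `|x| by rewrite -normrM ger0_norm // -expr2 sqr_ge0.
  by rewrite (nn A) (nn B); have := sqr_ge0 (`|A| - `|B|); lra.
have := normr_ge0 (zr R r).
set a := `|zr R r|; set q := `|A| * `|B|; set S := A * A; set Q := B * B.
move=> ha hq hx; have : a * (q *+ 2) <= a * (S + Q) by apply: ler_wpM2l.
lra.
Qed.

End Positivity.

Lemma edge_perm_iota p : valid_perm p -> perm_eq (edge_perm p) (iota 0 15).
Proof.
case/andP=> _ /andP[_] /andP[_] /andP[us] /andP[/allP lts _].
have ss : size (edge_perm p) = 15%N by rewrite size_map.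
apply: uniq_perm; rewrite ?iota_uniq //.
have sub : {subset edge_perm p <= iota 0 15} by move=> i /lts; rewrite mem_iota.
by have [] := uniq_min_size us sub; rewrite ?ss.
Qed.

(** * From checked certificates to inequalities between sums *)

Section Soundness.
Variables (R : realFieldType) (I : finType) (i0 : I) (u : I -> I -> R).
Hypothesis u_sym : forall x y, u x y = u y x.
Hypothesis u_le1 : forall x y, `|u x y| <= 1.

Let T (u : I -> I -> R) b := esum i0 6 (fun v => mono id b (values u v)).
Let Q (u : I -> I -> R) b := esum i0 6 (fun v => mono (+%R 1) b (values u v)).
Let nu x y := - u x y.
Let TT b := T u b + T nu b.

Lemma nu_sym x y : nu x y = nu y x. Proof. by rewrite /nu u_sym. Qed.
Lemma nu_le1 x y : `|nu x y| <= 1. Proof. by rewrite normrN. Qed.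

Lemma values_opp v : values nu v = [seq - x | x <- values u v].
Proof. by rewrite -map_comp. Qed.

Lemma odd_eq0 b : size b = 15%N -> parity b -> TT b = 0.
Proof.
move=> sb pb; rewrite /TT /T -esumD -[RHS](mulr0 (#|I|%:R ^+ 6)) -(esum_const i0 6 (0 : R)).
apply: esum_ext => v.
by rewrite values_opp mono_opp ?sb ?size_values // pb expr1 mulN1r subrr.
Qed.

Lemma esum_mono_relabel f w b p : (forall x y, w x y = w y x) -> size b = 15%N ->
  valid_perm p ->
  esum i0 6 (fun v => mono f (relabel (edge_perm p) b) (values w v)) =
  esum i0 6 (fun v => mono f b (values w v)) :> R.
Proof.
move=> wsym sb vp; rewrite (esum_relabel i0 (mono f _) wsym vp).
apply: esum_ext => v; apply: (mono_relabel f sb (size_values w v)).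
exact: edge_perm_iota.
Qed.

Lemma edge_perms6P s : s \in edge_perms6 -> exists2 p, valid_perm p & s = edge_perm p.
Proof. by case/mapP=> p; rewrite mem_filter => /andP[vp _] ->; exists p. Qed.

(** Each key written to the table is a relabelling of the representative stored under it, and sums
    over vertex maps are invariant under relabelling. A key that is absent represents itself. *)
Lemma class_rep_sound reps : all (fun r : bitseq => size r == 15%N) reps ->
  forall b, size b = 15%N ->
  TT (class_rep (table reps) b) = TT b /\ size (class_rep (table reps) b) = 15%N.
Proof.
move=> sr b sb; rewrite /class_rep; case E: (lookup _ _) => [r|//].
pose P (b r : bitseq) := TT r = TT b /\ size r = 15%N.
suff H : trie_all P (table reps) by exact: (trie_all_lookup H E).
rewrite /table; have := edge_perms6P; move: edge_perms6 => ss hss {E}.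
have : trie_all P Empty by [].
elim: reps sr Empty => //= r' reps IH /andP[/eqP sr' /IH{}IH] t Pt; apply: IH.
elim: ss t Pt hss => //= s ss IHs t Pt hss; apply: IHs; last first.
  by move=> s' hs'; apply: hss; rewrite inE hs' orbT.
have [|p vp ->] := hss s; first by rewrite inE eqxx.
apply: trie_all_update => //; split=> //.
by rewrite /TT /T !esum_mono_relabel // => x y; rewrite nu_sym.
Qed.

Lemma lin_add p : lin TT p = lin (T u) p + lin (T nu) p.
Proof. by rewrite /lin -big_split; apply: eq_bigr => m _; rewrite mulrDr. Qed.

Lemma lin_ge0 (J : eqType) (F : J -> edge_poly) r :
  (forall w, (forall x y, `|w x y| <= 1) -> forall j, j \in r -> 0 <= lin (T w) (F j)) ->
  0 <= lin TT (flatten (map F r)).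
Proof.
move=> H; rewrite lin_flatten big_map big_seq; apply: sumr_ge0 => j jr.
by rewrite lin_add addr_ge0 // H //; exact: nu_le1.
Qed.

Lemma size_scale k p : all (fun m => size m.2 == 15%N) (scale k p) =
  all (fun m => size m.2 == 15%N) p.
Proof. by rewrite all_map. Qed.

Lemma size_residual m : size m.2 = 15%N -> all (fun m => size m.2 == 15%N) (residual m).
Proof.
case: m => r b /= sb; rewrite /residual /=; case: ifP => //= _.
by rewrite sb /cherry_like !size_cat !size_take !size_drop sb.
Qed.

(** Under [TT] one has 2 k obj = q + res + 2 sq, and each term on the right is nonnegative: diagonal
    terms, compensated errors and squares. *)
Lemma certifies_sound reps k obj cert : all (fun r : bitseq => size r == 15%N) reps ->
  all (fun m => size m.2 == 15%N) obj ->
  Z.ltb Z0 k -> certifies (table reps) k obj cert -> 0 <= lin TT obj.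
Proof.
move=> sr so k0; have crs := class_rep_sound sr.
rewrite /certifies => /andP[/allP wf].
set sq := flatten (map squares cert).
have ssq : all (fun m => size m.2 == 15%N) sq.
  apply/allP=> m /flattenP[_ /mapP[B HB ->]]; exact: (allP (size_squares (wf B HB))).
set r0 := _ ++ scale (Zneg xH) sq; set r := normalize _ r0.
have [sr1 Er] : all (fun m => size m.2 == 15%N) r /\ lin TT r = lin TT r0.
  by apply: (lin_normalize crs odd_eq0); rewrite all_cat !size_scale so.
set res := flatten (map residual r).
have sres : all (fun m => size m.2 == 15%N) res.
  by apply/allP=> m /flattenP[_ /mapP[B /(allP sr1) /eqP HB ->]]; apply: (allP (size_residual HB)).
set q0 := _ ++ scale (Zneg xH) res; set q := normalize _ q0.
have [_ Eq] : all (fun m => size m.2 == 15%N) q /\ lin TT q = lin TT q0.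
  by apply: (lin_normalize crs odd_eq0); rewrite all_cat !size_scale sr1.
move=> /allP hq.
have q_ge0 : 0 <= lin TT q.
  rewrite /lin big_seq; apply: sumr_ge0 => m /hq.
  case/orP=> [/Z.eqb_spec ->|/andP[z0 /mapP[i Hi Em]]]; first by rewrite zr0 mul0r.
  apply: mulr_ge0; first exact: zr_ge0.
  rewrite Em addr_ge0 // cherry_like_ge0 //;
    by apply: size_flag; move: Hi; rewrite !inE => /or4P[] /eqP ->.
have res_ge0 : 0 <= lin TT res.
  by apply: lin_ge0 => w hw m /(allP sr1) /eqP sm; apply: residual_ge0.
have sq_ge0 : 0 <= lin TT sq by apply: lin_ge0 => w hw B /wf; apply: squares_ge0.
move: Eq; rewrite lin_cat !lin_scale Er lin_cat !lin_scale zr2 zrN1.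
move: q_ge0 res_ge0 sq_ge0.
set a := lin TT q; set b := lin TT res; set c := lin TT sq; set d := lin TT obj => ? ? ? E.
have : 0 <= zr R k * d by lra.
by rewrite pmulr_rge0 // zr_gt0.
Qed.

Lemma sum_submasks b (xs : seq R) : (size b <= size xs)%N ->
  \sum_(m <- submasks b) mono id m xs = mono (+%R 1) b xs.
Proof.
elim: b xs => [|c b IH] [|x xs] //=; rewrite ?big_seq1 //.
rewrite ltnS => /IH {}IH; rewrite big_cat /= big_map /=.
under eq_bigr do rewrite mul1r.
rewrite IH; case: c; last by rewrite big_nil addr0 mul1r.
by rewrite big_map /= -mulr_sumr IH; ring.
Qed.

Lemma size_submasks b : all (fun m => size m == size b) (submasks b).
Proof.
elim: b => //= c b IH; rewrite all_cat all_map IH /=.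
by case: c => //=; rewrite all_map.
Qed.

Lemma size_ones b : size b = 15%N ->
  all (fun m : Z * bitseq => size m.2 == 15%N) (ones (submasks b)).
Proof. by move=> sb; rewrite all_map -sb size_submasks. Qed.

Lemma lin_submasks b : size b = 15%N -> lin TT (ones (submasks b)) = Q u b + Q nu b.
Proof.
move=> sb; rewrite lin_add /lin !big_map /=.
have E w : \sum_(m <- submasks b) zr R (Zpos xH) * T w m = Q w b.
  under eq_bigr do rewrite zr1 mul1r.
  rewrite /T -esum_sum; apply: esum_ext => v.
  by rewrite sum_submasks // sb size_values.
by rewrite !E.
Qed.

Lemma size_graph_mask n h : size (graph_mask n h) = 15%N.
Proof. by rewrite size_takel // size_cat size_nseq leq_addl. Qed.

Lemma size_cone_mask n h : size (cone_mask n h) = 15%N.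
Proof. by rewrite size_takel // !size_cat !size_nseq addnA leq_addl. Qed.

Lemma dom_poly_sound reps k n h cert : all (fun r : bitseq => size r == 15%N) reps ->
  Z.ltb Z0 k -> certifies (table reps) k (dom_poly n h) cert ->
  Q u (graph_mask n h) + Q nu (graph_mask n h) <= Q u (cone_mask n h) + Q nu (cone_mask n h).
Proof.
move=> sr k0 /(certifies_sound sr _ k0).
rewrite all_cat size_scale !size_ones ?size_graph_mask ?size_cone_mask // => /(_ isT).
rewrite lin_cat lin_scale !lin_submasks ?size_graph_mask ?size_cone_mask // zrN1 mulN1r.
by rewrite subr_ge0.
Qed.

Lemma base_poly_sound reps k n h cert : all (fun r : bitseq => size r == 15%N) reps ->
  Z.ltb Z0 k -> certifies (table reps) k (base_poly n h) cert ->
  #|I|%:R ^+ 6 * 2%:R <= Q u (graph_mask n h) + Q nu (graph_mask n h).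
Proof.
move=> sr k0 /(certifies_sound sr _ k0).
rewrite all_cat !size_ones ?size_graph_mask // => /(_ isT).
rewrite lin_cat !lin_submasks ?size_graph_mask // {1}/lin big_seq1 zrN1 mulN1r.
have E w : T w (nseq 15 false) = #|I|%:R ^+ 6.
  by rewrite /T -[RHS]mulr1 -(esum_const i0); apply: esum_ext => v; rewrite mono_nseqF.
by rewrite /= /TT !E subr_ge0 mulr_natr mulr2n.
Qed.

Lemma Q_relabel b s : size b = 15%N -> s \in edge_perms6 ->
  Q u (relabel s b) + Q nu (relabel s b) = Q u b + Q nu b.
Proof.
move=> sb /edge_perms6P[p vp ->].
by rewrite /Q !esum_mono_relabel // => x y; rewrite nu_sym.
Qed.
End Soundness.

(** * The inequality for symmetric matrices *)

Lemma mem_all_bits b : b \in all_bits (size b).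
Proof.
elim: b => //= c b IH; rewrite mem_cat; case: c; apply/orP; [right | left];
  exact: map_f.
Qed.

Lemma mem_pairs n i j : ((i, j) \in pairs n) = (i < j < n)%N.
Proof.
apply/flattenP/idP => [[_ /mapP[j' Hj' ->] /mapP[i' Hi' [-> ->]]]|/andP[ij jn]].
  by move: Hj' Hi'; rewrite !mem_iota /= !add0n => -> ->.
exists [seq (i, j) | i <- iota 0 j]; last by apply: map_f; rewrite mem_iota.
by apply: (map_f (fun j => [seq (i, j) | i <- iota 0 j])); rewrite mem_iota.
Qed.

Lemma pairsS n : pairs n.+1 = pairs n ++ [seq (i, n) | i <- iota 0 n].
Proof. by rewrite /pairs -[in LHS]addn1 iotaD map_cat flatten_cat /= cats0 add0n. Qed.

Lemma values6 n : (n <= 5)%N -> exists s,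
  pairs 6 = pairs n ++ [seq (i, n) | i <- iota 0 n] ++ s /\ (size s <= 15)%N.
Proof. by case: n => [|[|[|[|[|[|]]]]]] // _; eexists; split; try reflexivity. Qed.

Lemma mono_take (R : comRingType) (f : R -> R) k b xs : (size xs <= k)%N ->
  mono f (take k b) xs = mono f b xs.
Proof.
by elim: k b xs => [|k IH] [|c b] [|x xs] //=; rewrite ltnS => /IH ->.
Qed.

Lemma mono_nseqT (R : comRingType) (f : R -> R) xs :
  mono f (nseq (size xs) true) xs = \prod_(x <- xs) f x.
Proof. by elim: xs => [|x xs IH]; rewrite /= ?big_nil // big_cons IH. Qed.

Section FiniteInequality.
Variables (R : realFieldType) (I : finType) (i0 : I).
Let N : R := #|I|%:R.

Definition pair_values (u : I -> I -> R) n v := [seq u (v e.1) (v e.2) | e <- pairs n].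

Lemma mono_graph_mask f u n h v : (n <= 5)%N -> size h = size (pairs n) ->
  mono f (graph_mask n h) (values u v) = mono f h (pair_values u n v).
Proof.
move=> n5 sh; rewrite mono_take ?size_values //.
have [s [E ss]] := values6 n5.
rewrite /values E map_cat mono_cat ?size_map // -/(pair_values u n v).
by rewrite mono_nseqF mulr1.
Qed.

Lemma mono_cone_mask f u n h v : (n <= 5)%N -> size h = size (pairs n) ->
  mono f (cone_mask n h) (values u v) =
  mono f h (pair_values u n v) * \prod_(i <- iota 0 n) f (u (v i) (v n)).
Proof.
move=> n5 sh; rewrite mono_take ?size_values //.
have [s [E ss]] := values6 n5.
rewrite /values E !map_cat mono_cat ?size_map // -/(pair_values u n v).
rewrite mono_cat ?size_nseq ?size_map ?size_iota // mono_nseqF mulr1 -map_comp.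
congr (_ * _); rewrite -[X in nseq X](size_iota 0) -[X in nseq X](size_map (fun i => u (v i) (v n))).
by rewrite mono_nseqT big_map.
Qed.

Definition depends_below n (G : (nat -> I) -> R) :=
  forall v v', (forall i, (i < n)%N -> v i = v' i) -> G v = G v'.

Lemma depends_upd n k G v y : depends_below n G -> (n <= k)%N -> G (upd v k y) = G v.
Proof. by move=> dG le_nk; apply: dG => i lt_in; rewrite /upd ltn_eqF // (leq_trans lt_in). Qed.

Lemma esum_dummy n m G : depends_below n G -> esum i0 (n + m) G = N ^+ m * esum i0 n G.
Proof.
move=> dG; elim: m => [|m IH]; first by rewrite addn0 mul1r.
rewrite addnS esumS exprS -mulrA -IH -esumZ; apply: esum_ext => v.
under eq_bigr do rewrite (depends_upd _ _ dG) ?leq_addr //.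
by rewrite sumr_const mulr_natl.
Qed.

Lemma depends_mono f u n h : depends_below n (fun v => mono f h (pair_values u n v)).
Proof.
move=> v v' E; congr mono; apply/eq_in_map => -[i j]; rewrite mem_pairs => /andP[ij jn] /=.
by rewrite !E // (ltn_trans ij).
Qed.

(** Given the images of the first n vertices, the a added ones are summed independently with the
    same result, because they are pairwise non-adjacent. *)
Lemma esum_pow n a (P : (nat -> I) -> R) (C : (nat -> I) -> I -> R) :
  depends_below n P -> (forall y, depends_below n (C^~ y)) ->
  esum i0 (n + a) (fun v => P v * \prod_(j < a) C v (v (n + j)%N)) =
  esum i0 n (fun v => P v * (\sum_y C v y) ^+ a).
Proof.
move=> dP dC.
(* The exponent [b] counts the added vertices already summed out, [m] those that remain. *)
have H m b : esum i0 (n + m) (fun v => P v * (\sum_y C v y) ^+ b * \prod_(j < m) C v (v (n + j)%N)) =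
    esum i0 n (fun v => P v * (\sum_y C v y) ^+ (b + m)).
  elim: m b => [|m IH] b.
    by rewrite !addn0; apply: esum_ext => v; rewrite big_ord0 mulr1.
  rewrite addnS esumS addnS -addSn -IH; apply: esum_ext => v.
  have updC k y z : (n <= k)%N -> C (upd v k y) z = C v z by exact: (depends_upd v y (dC z)).
  have updP k y : (n <= k)%N -> P (upd v k y) = P v by exact: (depends_upd v y dP).
  transitivity (\sum_y P v * (\sum_z C v z) ^+ b * (\prod_(j < m) C v (v (n + j)%N) * C v y)).
    apply: eq_bigr => y _; rewrite updP ?leq_addr //; congr (_ * _ ^+ _ * _).
      by apply: eq_bigr => z _; rewrite updC ?leq_addr.
    rewrite big_ord_recr /= updC ?leq_addr //; congr (_ * _); last by rewrite /upd eqxx.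
    by apply: eq_bigr => j _; rewrite updC ?leq_addr // /upd eqn_add2l ltn_eqF.
  by rewrite -mulr_sumr -mulr_sumr exprSr; ring.
by rewrite -(H a 0%N); apply: esum_ext => v; rewrite expr0 mulr1.
Qed.

(** The classification supplies an entry isomorphic to [h], and both of its bounds are transported
    along the relabelling. *)
Lemma graph_bounds (u : I -> I -> R) n h :
  (forall x y, u x y = u y x) -> (forall x y, `|u x y| <= 1) ->
  (n <= 5)%N -> size h = size (pairs n) -> bipartite_mask n h -> connected_mask n h ->
  let Q u b := esum i0 6 (fun v => mono (+%R 1) b (values u v)) in
  let nu x y := - u x y in
  N ^+ 6 * 2%:R <= Q u (graph_mask n h) + Q nu (graph_mask n h) /\
  Q u (graph_mask n h) + Q nu (graph_mask n h) <= Q u (cone_mask n h) + Q nu (cone_mask n h).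
Proof.
move=> usym u1 n5 sh bh ch Q nu.
have := classification_holds; rewrite /classification.
move=> /allP /(_ n); rewrite mem_iota /= => /(_ n5) /allP /(_ h).
rewrite -sh mem_all_bits => /(_ isT); rewrite bh ch /covered lazy_hasE => /hasP[g ge].
case: ifPn => // /negbNE /eqP gn; case: ifPn => // _.
rewrite lazy_hasE => /hasP[s ses]; case: ifPn => // /eqP Eg /eqP Ec.
rewrite -Eg -Ec !(Q_relabel i0 usym) ?size_graph_mask ?size_cone_mask //.
have /andP[sr /allP /(_ g ge)] := entries_certified.
case: g gn {ge Eg Ec} => [[[m h0] [k c]] [k' c']] /= -> /and4P[k0 k0' cd cb].
by split; [exact: base_poly_sound sr k0' cb | exact: dom_poly_sound sr k0 cd].
Qed.

Definition hom_weight (u : I -> I -> R) n (A : nat -> nat -> bool) v :=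
  \prod_(e <- pairs n) (if A e.1 e.2 then 1 + u (v e.1) (v e.2) else 1).
Definition cone_weight (u : I -> I -> R) n v y := \prod_(i <- iota 0 n) (1 + u (v i) y).

Lemma hom_weightE u n A v :
  mono (+%R 1) [seq A e.1 e.2 | e <- pairs n] (pair_values u n v) = hom_weight u n A v.
Proof.
rewrite /hom_weight /pair_values; elim: (pairs n) => [|e s IH]; rewrite ?big_nil // big_cons /=.
by rewrite IH.
Qed.

(** The certificates speak of six vertices. The 6 - n vertices outside H and the 5 - n outside
    H^{+1} contribute powers of N, which cancel up to the one factor N in the second bound. *)
Lemma finite_bounds (u : I -> I -> R) n A (h := [seq A e.1 e.2 | e <- pairs n]) :
  (forall x y, u x y = u y x) -> (forall x y, `|u x y| <= 1) ->
  (n <= 5)%N -> bipartite_mask n h -> connected_mask n h ->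
  let P u := esum i0 n (fun v => hom_weight u n A v) in
  let F u := esum i0 n (fun v => hom_weight u n A v * \sum_y cone_weight u n v y) in
  let nu x y := - u x y in
  N ^+ n * 2%:R <= P u + P nu /\ N * (P u + P nu) <= F u + F nu.
Proof.
move=> usym u1 n5 bh ch P F nu.
have sh : size h = size (pairs n) by rewrite size_map.
have N0 : 0 < N by rewrite ltr0n; apply/card_gt0P; exists i0.
have dP w : depends_below n (hom_weight w n A).
  by move=> v v' E; rewrite -!hom_weightE; exact: (depends_mono _ _ _ E).
have dC w y : depends_below n ((cone_weight w n)^~ y).
  move=> v v' E; apply: eq_big_seq => i; rewrite mem_iota => /andP[_ lti].
  by rewrite E.
have EP w : esum i0 6 (fun v => mono (+%R 1) (graph_mask n h) (values w v)) = N ^+ (6 - n) * P w.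
  rewrite -(esum_dummy _ (dP w)) subnKC; last exact: leqW.
  by apply: esum_ext => v; rewrite mono_graph_mask // hom_weightE.
have EF w : esum i0 6 (fun v => mono (+%R 1) (cone_mask n h) (values w v)) = N ^+ (5 - n) * F w.
  have := esum_pow 1 (dP w) (dC w); rewrite addn1.
  under [X in _ = X -> _]esum_ext do rewrite expr1.
  rewrite -/(F w) => <-; rewrite -esum_dummy.
    rewrite (_ : (n.+1 + (5 - n) = 6)%N); last by rewrite addSn subnKC.
    apply: esum_ext => v; rewrite mono_cone_mask // hom_weightE big_ord1 addn0.
    by [].
  move=> v v' E; rewrite !big_ord1 addn0 E //; congr (_ * _).
    by apply: dP => i lti; apply: E; exact: ltnW.
  by apply: dC => i lti; apply: E; exact: ltnW.
have := graph_bounds usym u1 n5 sh bh ch; rewrite /= !EP !EF -!mulrDr.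
have -> : (6 - n = (5 - n).+1)%N by rewrite subSn.
case=> h1 h2; split.
  move: h1; rewrite (_ : N ^+ 6 = N ^+ (5 - n).+1 * N ^+ n); last first.
    by rewrite -exprD addSn subnK.
  by rewrite -mulrA ler_pM2l ?exprn_gt0.
by move: h2; rewrite exprSr -mulrA ler_pM2l ?exprn_gt0.
Qed.

(** Bernoulli's inequality for F / l, multiplied by l^(a+1); it is used with l = N because the sums
    are not normalized. In the induction step the excess is a nonnegative multiple of (F - l)^2. *)
Lemma bernoulli_shift (F l : R) a : 0 <= F -> 0 < l ->
  l ^+ a.+1 + a.+1%:R * (l ^+ a * (F - l)) <= F ^+ a.+1.
Proof.
move=> F0 l0; elim: a => [|a IH]; first by rewrite !expr1 expr0 !mul1r addrC subrK.
rewrite [in leRHS]exprS; apply: le_trans (ler_wpM2l F0 IH).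
rewrite -subr_ge0 [l ^+ a.+2]exprS [l ^+ a.+1]exprS -[a.+2%:R]natr1.
set b := a.+1%:R; set m := l ^+ a.
have -> : F * (l * m + b * (m * (F - l))) -
    (l * (l * m) + (b + 1) * (l * m * (F - l))) = b * (m * (F - l) ^+ 2) by ring.
by rewrite mulr_ge0 ?ler0n // mulr_ge0 ?sqr_ge0 // exprn_ge0 // ltW.
Qed.

Definition cone_sum n a A (u : I -> I -> R) := esum i0 (n + a) (fun v =>
  hom_weight u n A v * \prod_(j < a) cone_weight u n v (v (n + j)%N)).

Lemma finite_inequality (u : I -> I -> R) n a A (h := [seq A e.1 e.2 | e <- pairs n]) :
  (forall x y, u x y = u y x) -> (forall x y, `|u x y| <= 1) ->
  (n <= 5)%N -> (0 < a)%N -> bipartite_mask n h -> connected_mask n h ->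
  N ^+ (n + a) * 2%:R <= cone_sum n a A u + cone_sum n a A (fun x y => - u x y).
Proof.
case: a => // a usym u1 n5 _ bh ch.
have [hP hF] := finite_bounds usym u1 n5 bh ch.
have N0 : 0 < N by rewrite ltr0n; apply/card_gt0P; exists i0.
have u_ge0 (w : I -> I -> R) : (forall x y, `|w x y| <= 1) -> forall x y, 0 <= 1 + w x y.
  by move=> w1 x y; have := w1 x y; rewrite ler_norml => /andP[? _]; lra.
have HS (w : I -> I -> R) : (forall x y, `|w x y| <= 1) ->
    N ^+ a.+1 * esum i0 n (hom_weight w n A) + a.+1%:R * (N ^+ a *
      (esum i0 n (fun v => hom_weight w n A v * \sum_y cone_weight w n v y) -
       N * esum i0 n (hom_weight w n A))) <= cone_sum n a.+1 A w.
  move=> w1; rewrite /cone_sum esum_pow; first last.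
  - move=> y v v' E; apply: eq_big_seq => i; rewrite mem_iota => /andP[_ lti].
    by rewrite E.
  - by move=> v v' E; rewrite -!hom_weightE; exact: (depends_mono _ _ _ E).
  apply: le_trans (_ : esum i0 n (fun v => N ^+ a.+1 * hom_weight w n A v +
      (a.+1%:R * N ^+ a) * (hom_weight w n A v * \sum_y cone_weight w n v y) +
      (- (a.+1%:R * N ^+ a * N)) * hom_weight w n A v) <= _).
    by rewrite !esumD !esumZ le_eqVlt; apply/orP; left; apply/eqP; ring.
  apply: ler_esum => v.
  set p := hom_weight w n A v; set f := \sum_y _.
  have p0 : 0 <= p by apply: prodr_ge0 => e _; case: ifP => // _; apply: u_ge0.
  have f0 : 0 <= f by apply: sumr_ge0 => y _; apply: prodr_ge0 => i _; apply: u_ge0.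
  apply: le_trans (ler_wpM2l p0 (bernoulli_shift a f0 N0)).
  by rewrite le_eqVlt; apply/orP; left; apply/eqP; ring.
have nu1 x y : `|- u x y| <= 1 by rewrite normrN.
have := lerD (HS u u1) (HS _ nu1); apply: le_trans.
move: hP hF => /=.
set P1 := esum i0 n (fun v => hom_weight u n A v).
set P2 := esum i0 n (fun v => hom_weight (fun x y => - u x y) n A v).
set F1 := esum i0 n (fun v => hom_weight u n A v * \sum_y cone_weight u n v y).
set F2 := esum i0 n (fun v => hom_weight (fun x y => - u x y) n A v *
  \sum_y cone_weight (fun x y => - u x y) n v y).
move=> hP hF.
(* By [hF] the first-order terms of the two signs have a nonnegative sum; by [hP] the zeroth-order
   terms already reach the bound. *)
have hb : 0 <= a.+1%:R * (N ^+ a * (F1 + F2 - N * (P1 + P2))).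
  by rewrite mulr_ge0 ?ler0n // mulr_ge0 ?subr_ge0 // exprn_ge0 // ltW.
have hc : N ^+ (n + a.+1) * 2%:R <= N ^+ a.+1 * (P1 + P2).
  by rewrite exprD mulrAC mulrC ler_pM2l ?exprn_gt0.
apply: le_trans hc _; rewrite -subr_ge0; apply: le_trans hb _.
by rewrite le_eqVlt; apply/orP; left; apply/eqP; ring.
Qed.

End FiniteInequality.

(** * Iterated integrals over the cube *)

Section CubeIntegral.
Local Open Scope classical_set_scope.
Local Open Scope ring_scope.
Local Open Scope ereal_scope.
Variable R : realType.
Local Notation mu := (@lebesgue_measure R).
Local Notation D := (`[0%R, 1%R]%classic : set R).
Implicit Types (f : (nat -> R) -> \bar R) (v : nat -> R).

Definition put v k (x : R) : nat -> R := fun i => if i == k then x else v i.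

(** The outermost integral comes first in [s]. Unlike [cube_integral], this allows coordinates in
    any order, so that they can be permuted, dropped and renamed. *)
Fixpoint iter_int (s : seq nat) f v : \bar R :=
  if s is k :: s' then \int[mu]_(x in D) iter_int s' f (put v k x) else f v.

(* Measurability of a function of a sequence, tested along measurable families of sequences. *)
Definition seq_measurable f := forall d (T : measurableType d) (v : T -> nat -> R),
  (forall i, measurable_fun setT ((v^~ i) : T -> R)) -> measurable_fun setT ((fun t => f (v t)) : T -> \bar R).

(** The hypotheses of Tonelli's theorem, in a form preserved by integrating out a coordinate. *)
Definition good f := seq_measurable f /\ (forall v, 0 <= f v).

Lemma measurable_D : measurable D. Proof. exact: measurable_itv. Qed.

Lemma integral_cst_D c : \int[mu]_(x in D) c = c.
Proof.
transitivity (c * mu D); first exact: (integral_cst mu measurable_D).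
rewrite lebesgue_measure_itv /= lte_fin ltr01.
by rewrite EFinN oppe0 adde0 mule1.
Qed.

Lemma put_measurable d (T : measurableType d) (v : T -> nat -> R) k :
  (forall i, measurable_fun setT ((v^~ i) : T -> R)) ->
  forall i, measurable_fun setT ((fun z => put (v z.1) k z.2 i) : T * R -> R).
Proof.
move=> mv i; rewrite /put; case: eqP => _; first exact: measurable_snd.
exact: (measurableT_comp (mv i) measurable_fst).
Qed.

Lemma integral_D (h : R -> \bar R) : \int[mu]_(x in D) h x = \int[mu]_x (h \_ D) x.
Proof. exact: integral_mkcond. Qed.

Lemma good_int k f : good f -> good (fun v => \int[mu]_(x in D) f (put v k x)).
Proof.
case=> mf f0; split=> [d T v mv|v]; last by apply: integral_ge0 => x _.
pose g (z : T * R) := f (put (v z.1) k z.2).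
have mg : measurable_fun setT g by apply: mf; exact: put_measurable.
have mgD : measurable_fun setT (g \_ (setT `*` D)).
  apply/(measurable_restrictT _ (measurableX measurableT measurable_D)).
  exact: measurable_funTS.
have g0 z : 0 <= (g \_ (setT `*` D)) z by rewrite patchE; case: ifP => // _; exact: f0.
have := @measurable_fun_fubini_tonelli_F _ _ _ _ _ mu _ mgD g0.
congr measurable_fun; apply/funext => t; rewrite /fubini_F integral_D.
apply: eq_integral => x _; rewrite !patchE /g.
by rewrite (_ : ((t, x) \in setT `*` D) = (x \in D)) // in_setX in_setT.
Qed.

Lemma good_iter s f : good f -> good (iter_int s f).
Proof. by move=> gf; elim: s => //= k s; exact: good_int. Qed.

Lemma measurable_put v k f : good f -> measurable_fun D ((fun x => f (put v k x)) : R -> \bar R).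
Proof.
case=> mf _; apply: measurable_funTS; apply: mf => i; rewrite /put.
by case: eqP => _; [exact: measurable_id | exact: measurable_cst].
Qed.

Lemma putC v k l x y : k != l -> put (put v k x) l y = put (put v l y) k x.
Proof.
move=> kl; apply/funext => i; rewrite /put; case: eqP => [->|//].
by rewrite eq_sym (negbTE kl).
Qed.

Lemma int_swap v k l f : good f -> k != l ->
  \int[mu]_(x in D) \int[mu]_(y in D) f (put (put v k x) l y) =
  \int[mu]_(y in D) \int[mu]_(x in D) f (put (put v l y) k x).
Proof.
case=> mf f0 kl.
pose g (z : R * R) := f (put (put v k z.1) l z.2).
have mg : measurable_fun setT g.
  apply: (mf _ _ (fun z : R * R => put (put v k z.1) l z.2)) => i; rewrite /put.
  case: eqP => _; first exact: measurable_snd.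
  by case: eqP => _; [exact: measurable_fst | exact: measurable_cst].
have mgD : measurable_fun setT (g \_ (D `*` D)).
  apply/(measurable_restrictT _ (measurableX measurable_D measurable_D)).
  exact: measurable_funTS.
have g0 z : 0 <= (g \_ (D `*` D)) z by rewrite patchE; case: ifP => // _; exact: f0.
have E := @fubini_tonelli _ _ _ _ _ mu mu _ mgD g0.
transitivity (\int[mu]_x \int[mu]_y (g \_ (D `*` D)) (x, y)).
  rewrite integral_D; apply: eq_integral => x _; rewrite patchE.
  case: ifP => xD; last first.
    rewrite integral0_eq // => y _; rewrite patchE in_setX.
    by rewrite xD.
  by rewrite integral_D; apply: eq_integral => y _; rewrite !patchE in_setX xD.
rewrite E integral_D; apply: eq_integral => y _; rewrite patchE.
case: ifP => yD; last first.
  rewrite integral0_eq // => x _; rewrite patchE in_setX.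
  by rewrite yD andbF.
rewrite integral_D; apply: eq_integral => x _; rewrite !patchE in_setX yD andbT /g /=.
by rewrite putC.
Qed.

Lemma iter_front s f v k : good f -> uniq s -> k \in s ->
  iter_int s f v = iter_int (k :: rem k s) f v.
Proof.
move=> gf; elim: s v => //= l s IH v /andP[ls us]; rewrite inE eq_sym.
case: eqP => [->//|/eqP lk] /= ks.
rewrite -int_swap //=; last exact: good_iter.
by apply: eq_integral => x _; rewrite IH.
Qed.

Lemma iter_perm s s' f v : good f -> uniq s -> perm_eq s s' ->
  iter_int s f v = iter_int s' f v.
Proof.
move=> gf; elim: s' s v => [|k s' IH] s v us ps; first by rewrite (perm_nilP ps).
have ks : k \in s by rewrite (perm_mem ps) inE eqxx.
rewrite (iter_front _ gf us ks) /=; apply: eq_integral => x _; apply: IH.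
  exact: rem_uniq.
by rewrite -(perm_cons k) (perm_trans _ ps) // perm_sym perm_to_rem.
Qed.

Lemma iter_cst s (c : \bar R) v : iter_int s (fun=> c) v = c.
Proof.
elim: s v => //= k s IH v; under eq_integral do rewrite IH.
exact: integral_cst_D.
Qed.

Lemma iter_insensitive s f v k x : (forall w y, f (put w k y) = f w) ->
  iter_int s f (put v k x) = iter_int s f v.
Proof.
move=> fk; elim: s v => //= l s IH v; apply: eq_integral => y _.
have [->|lk] := eqVneq l k; last by rewrite putC 1?eq_sym // IH.
by congr iter_int; apply/funext => i; rewrite /put; case: eqP.
Qed.

Lemma iter_dummy s s' f v : (forall k, k \in s' -> forall w y, f (put w k y) = f w) ->
  iter_int (s' ++ s) f v = iter_int s f v.
Proof.
elim: s' v => //= k s' IH v fk.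
under eq_integral => x _.
  rewrite IH; last by move=> l ls; apply: fk; rewrite inE ls orbT.
  rewrite iter_insensitive; last by apply: fk; rewrite inE eqxx.
over.
exact: integral_cst_D.
Qed.

Lemma iter_rename (phi : nat -> nat) k s f w w' :
  (forall v v', (forall i, (i < k)%N -> v i = v' i) -> f v = f v') ->
  {in gtn k &, injective phi} -> all (gtn k) s ->
  (forall i, (i < k)%N -> w (phi i) = w' i) ->
  iter_int (map phi s) (fun x => f (fun i => x (phi i))) w = iter_int s f w'.
Proof.
move=> fk inj; elim: s w w' => [|j s IH] w w' /=; first by move=> _ E; apply: fk.
move=> /andP[jk sk] E; apply: eq_integral => x _; apply: IH => // i ik.
by rewrite /put (inj_in_eq inj) // E.
Qed.

Lemma iter_sum (J : Type) (r : seq J) (F : J -> (nat -> R) -> \bar R) s v :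
  (forall j, good (F j)) ->
  iter_int s (fun w => \sum_(j <- r) F j w) v = \sum_(j <- r) iter_int s (F j) v.
Proof.
move=> gF; elim: s v => //= k s IH v.
under eq_integral do rewrite IH.
rewrite (ge0_integral_sum mu measurable_D) // => j.
  exact: (measurable_put _ _ (good_iter s (gF j))).
by move=> x _; have [_] := good_iter s (gF j); apply.
Qed.

Lemma iter_le s f g v : good f -> good g ->
  (forall w, (forall i, w i \in `[0%R, 1%R]) -> f w <= g w) ->
  (forall i, v i \in `[0%R, 1%R]) -> iter_int s f v <= iter_int s g v.
Proof.
move=> gf gg fg; elim: s v => [|k s IH] v hv /=; first exact: fg.
apply: ge0_le_integral; first exact: measurable_D.
- by move=> x _; have [_] := good_iter s gf; apply.
- exact: (measurable_put _ _ (good_iter s gf)).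
- exact: (measurable_put _ _ (good_iter s gg)).
move=> x Dx; apply: IH => i; rewrite /put; case: eqP => // _; exact: Dx.
Qed.

(** [cube_integral] has its last coordinate outermost, whence the reversed list; coordinates from k
    on are frozen at [v]. *)
Lemma cube_iter k f v :
  cube_integral k (fun w => f (fun i => if (i < k)%N then w i else v i)) =
  iter_int (rev (iota 0 k)) f v.
Proof.
elim: k v => [|k IH] v //.
rewrite (_ : rev (iota 0 k.+1) = k :: rev (iota 0 k)); last by rewrite -addn1 iotaD rev_cat.
rewrite /=; apply: eq_integral => x _.
rewrite -IH; congr cube_integral; apply/funext => w; congr f; apply/funext => i.
by rewrite ltnS leq_eqVlt /put; case: eqP => //= ->; rewrite ltnn.
Qed.

Lemma cube_iter0 k f :
  (forall v v', (forall i, (i < k)%N -> v i = v' i) -> f v = f v') ->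
  cube_integral k f = iter_int (rev (iota 0 k)) f (fun=> 0%R).
Proof.
move=> fk; rewrite -cube_iter; congr cube_integral; apply/funext => w; apply: fk => i ik.
by rewrite ik.
Qed.

(** Among N independent uniform points, those selected by an injective map are again independent and
    uniform: the unselected coordinates integrate to 1 and the selected ones are renamed. *)
Lemma cube_sample (phi : nat -> nat) k N f : good f ->
  (forall v v', (forall i, (i < k)%N -> v i = v' i) -> f v = f v') ->
  {in gtn k &, injective phi} -> (forall i, (i < k)%N -> (phi i < N)%N) ->
  iter_int (rev (iota 0 N)) (fun x => f (fun i => x (phi i))) (fun=> 0%R) = cube_integral k f.
Proof.
move=> gf fk inj ltN.
have gphi : good (fun x => f (fun i => x (phi i))).
  case: gf => mf f0; split=> [d T v mv|v]; last exact: f0.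
  exact: (mf _ _ (fun t i => v t (phi i))).
set im := map phi (rev (iota 0 k)).
have uim : uniq im.
  rewrite map_inj_in_uniq ?rev_uniq ?iota_uniq // => i j.
  by rewrite !mem_rev !mem_iota; apply: inj.
rewrite (iter_perm (s' := [seq i <- iota 0 N | i \notin im] ++ im)) //; last first.
- apply: uniq_perm; rewrite ?rev_uniq ?iota_uniq // ?cat_uniq ?filter_uniq ?iota_uniq // ?uim ?andbT.
    by apply/hasPn => i; rewrite mem_filter => ->.
  move=> i; rewrite mem_rev mem_cat mem_filter mem_iota /=.
  have [/mapP[j + ->]|_] /= := boolP (i \in im); last by rewrite orbF.
  by rewrite mem_rev mem_iota => /andP[_ /ltN ->].
- by rewrite rev_uniq iota_uniq.
rewrite iter_dummy => [|l]; last first.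
  rewrite mem_filter => /andP[lim _] w y; apply: fk => i ik; rewrite /put.
  case: eqP => // E; move: lim; rewrite -E map_f // mem_rev mem_iota.
  by [].
rewrite cube_iter0 //; apply: (iter_rename (k := k)) => //.
by apply/allP => i; rewrite mem_rev mem_iota.
Qed.

End CubeIntegral.

(** * Sampling a graphon *)

Lemma ffact_leq_expn N k : (N ^_ k <= N ^ k)%N.
Proof.
elim: k => [|k IH] //; rewrite ffactnSr expnSr leq_mul //; exact: leq_subr.
Qed.

(** At most a fraction k^2 / N of all maps is non-injective, multiplied out to stay within the
    natural numbers. *)
Lemma expn_ffact_gap N k : (N * N ^ k <= N * N ^_ k + k ^ 2 * N ^ k)%N.
Proof.
elim: k => [|k IH]; first by rewrite expn0 ffactn0 muln1 addn0.
have le_k := ffact_leq_expn N k; rewrite ffactnSr expnS.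
have : (N ^_ k * N <= N ^_ k * (N - k) + k * N ^ k)%N.
  by rewrite mulnBr (mulnC k); have := leq_mul le_k (leqnn k); lia.
move: (N ^_ k * (N - k))%N (N ^ k)%N (N ^_ k)%N IH {le_k} => x p q IH; nia.
Qed.

Lemma cube_ext (R : realType) k (f g : (nat -> R) -> \bar R) :
  (forall v, (forall i, (i < k)%N -> v i \in `[0%R, 1%R]) -> f v = g v) ->
  cube_integral k f = cube_integral k g.
Proof.
elim: k f g => [|k IH] f g fg /=; first exact: fg.
apply: eq_integral => x; rewrite inE /= => Dx; apply: IH => v hv; apply: fg => i.
by rewrite ltnS leq_eqVlt; case: eqP => //= _; exact: hv.
Qed.

Lemma cube_integral_ge0 (R : realType) k (f : (nat -> R) -> \bar R) :
  (forall v, (0 <= f v)%E) -> (0 <= cube_integral k f)%E.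
Proof.
by elim: k f => [|k IH] f f0 //=; apply: integral_ge0 => x _; exact: IH.
Qed.

Lemma iter_adde (R : realDomainType) (x : \bar R) n : iter n (+%E x) 0%E = (n%:R%:E * x)%E.
Proof.
elim: n => [|n IH] /=; first by rewrite mul0e.
by rewrite IH -nat1r EFinD ge0_muleDl ?mul1e // lee_fin.
Qed.

Section Sampling.
Local Open Scope classical_set_scope.
Local Open Scope ring_scope.
Variables (R : realType) (k : nat) (B : rel 'I_k).
Implicit Types (U W : R -> R -> R) (v : nat -> R).

Definition edge_weight U v : R := \prod_(p : 'I_k * 'I_k | is_edge B p) U (v p.1) (v p.2).

Lemma edge_weight_good U :
  measurable_fun setT (fun p : R * R => U p.1 p.2) -> (forall x y, 0 <= U x y) ->
  good (fun v => (edge_weight U v)%:E).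
Proof.
move=> mU U0; split=> [d T v mv|v]; last by rewrite lee_fin prodr_ge0.
rewrite (_ : (fun t => _) = EFin \o (fun t =>
  \prod_(p <- [seq p <- index_enum _ | is_edge B p]) U (v t p.1) (v t p.2))); last first.
  by apply/funext => t; rewrite /= big_filter.
apply/measurable_EFinP; apply: measurable_prod => p _.
exact: (measurableT_comp mU (measurable_fun_pair (mv _) (mv _))).
Qed.

Lemma edge_weight_le1 U v : (forall x y, 0 <= U x y <= 1) -> edge_weight U v <= 1.
Proof. by move=> U01; apply: prodr_ile1. Qed.

Lemma edge_weight_below U v v' : (forall i, (i < k)%N -> v i = v' i) ->
  edge_weight U v = edge_weight U v'.
Proof. by move=> E; apply: eq_bigr => p _; rewrite !E. Qed.

(** Extension by zero makes measurability, symmetry and the bounds hold on the whole plane, as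
    [good] demands; the densities only see the unit square. *)
Definition restrict_unit W x y : R :=
  if (x \in `[0, 1]) && (y \in `[0, 1]) then W x y else 0.

Lemma mono_density_restrict W : mono_density B (restrict_unit W) = mono_density B W.
Proof.
rewrite /mono_density; congr (_ + _)%E; apply: cube_ext => v hv; congr EFin;
  by apply: eq_bigr => p _; rewrite /restrict_unit !hv.
Qed.

Lemma graphon_restrict W : is_graphon W ->
  [/\ measurable_fun setT (fun p : R * R => restrict_unit W p.1 p.2),
      forall x y, restrict_unit W x y = restrict_unit W y x &
      forall x y, 0 <= restrict_unit W x y <= 1].
Proof.
case=> mW [symW W01]; split.
- set D := `[0, 1]%classic : set R in mW.
  have mD : measurable (D `*` D) by apply: measurableX; exact: measurable_itv.
  have := (measurable_restrictT _ mD).1 mW; congr measurable_fun.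
  by apply/funext => -[x y]; rewrite patchE /restrict_unit in_setX /D !mem_setE.
- move=> x y; rewrite /restrict_unit andbC; case: ifP => // /andP[Dy Dx]; exact: symW.
- move=> x y; rewrite /restrict_unit; case: ifP => [/andP[Dx Dy]|_]; first exact: W01.
  by rewrite lexx ler01.
Qed.

(** The sum runs over all maps, so diagonal entries of [w] occur; for a sampled graphon they are the
    values W(v_i, v_i). *)
Definition finite_common (c : R) := forall N (w : 'I_N.+1 -> 'I_N.+1 -> R),
  (forall i j, w i j = w j i) -> (forall i j, 0 <= w i j <= 1) ->
  N.+1%:R ^+ k * c <= \sum_(phi : {ffun 'I_k -> 'I_N.+1})
    (\prod_(p : 'I_k * 'I_k | is_edge B p) w (phi p.1) (phi p.2) +
     \prod_(p : 'I_k * 'I_k | is_edge B p) (1 - w (phi p.1) (phi p.2))).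

Definition extend N (phi : {ffun 'I_k -> 'I_N.+1}) (i : nat) : nat :=
  if insub i is Some j then nat_of_ord (phi j) else 0.

Lemma extend_ord N (phi : {ffun 'I_k -> 'I_N.+1}) (i : 'I_k) : extend phi i = phi i.
Proof. by rewrite /extend valK. Qed.

Lemma edge_weight_extend U N (phi : {ffun 'I_k -> 'I_N.+1}) v :
  edge_weight U (fun i => v (extend phi i)) =
  \prod_(p : 'I_k * 'I_k | is_edge B p) U (v (phi p.1)) (v (phi p.2)).
Proof. by apply: eq_bigr => p _; rewrite !extend_ord. Qed.

(* N + 1 points are sampled: the injective maps contribute the density, and the other
   maps form a fraction O(1/N) of all maps. *)
Lemma mono_density_sample (c : R) W N : 0 <= c -> finite_common c -> is_graphon W ->
  ((N.+1%:R ^+ k * c)%:E <=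
   (N.+1 ^_ k)%:R%:E * mono_density B W + ((N.+1 ^ k - N.+1 ^_ k)%:R * 2)%:E)%E.
Proof.
move=> c0 fin gW; have [mW symW W01] := graphon_restrict gW.
rewrite -mono_density_restrict; move: (restrict_unit W) mW symW W01 => {gW}W mW symW W01.
pose V b := if b then W else fun x y => 1 - W x y.
have V01 b x y : 0 <= V b x y <= 1.
  by case: b; rewrite /V ?W01 //; have := W01 x y; lra.
have gV b : good (fun v => (edge_weight (V b) v)%:E).
  apply: edge_weight_good => [|x y]; last by have /andP[] := V01 b x y.
  by case: b => //; apply: measurable_funB => //; exact: measurable_cst.
pose F v : \bar R := (\sum_(b <- [:: true; false]) (edge_weight (V b) v)%:E)%E.
have gF : good F.
  split=> [d T v mv|v]; first by apply: emeasurable_sum => b; apply: (gV b).1.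
  by apply: sume_ge0 => b _; apply: (gV b).2.
have F2 v : (F v <= 2%:E)%E.
  rewrite /F sumEFin lee_fin !big_cons big_nil addr0.
  by have := edge_weight_le1 v (V01 true); have := edge_weight_le1 v (V01 false); lra.
have Fk v v' : (forall i, (i < k)%N -> v i = v' i) -> F v = F v'.
  by move=> E; rewrite /F; apply: eq_bigr => b _; rewrite (edge_weight_below _ E).
have EF : mono_density B W = cube_integral k F.
  rewrite cube_iter0 // iter_sum // !big_cons big_nil adde0 /mono_density /hom_density.
  suff D b : cube_integral k (fun v => (edge_weight (V b) v)%:E) =
      iter_int (rev (iota 0 k)) (fun v => (edge_weight (V b) v)%:E) (fun=> 0%R) by rewrite -!D.
  by rewrite cube_iter0 // => v v' E; rewrite (edge_weight_below _ E).
pose s := rev (iota 0 N.+1).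
pose S v := (\sum_(phi <- index_enum {ffun 'I_k -> 'I_N.+1}) F (fun i => v (extend phi i)))%E.
have gphi (phi : {ffun 'I_k -> 'I_N.+1}) : good (fun v => F (fun i => v (extend phi i))).
  case: gF => mF F0; split=> [d T v mv|v]; last exact: F0.
  exact: (mF _ _ (fun t i => v t (extend phi i))).
have gS : good S.
  split=> [d T v mv|v]; first by apply: emeasurable_sum => phi; apply: (gphi phi).1.
  by apply: sume_ge0 => phi _; apply: (gphi phi).2.
have gcst (x : R) : 0 <= x -> good (fun=> x%:E).
  by move=> x0; split=> [d T v mv|v]; [exact: measurable_cst | rewrite lee_fin].
have in01 (i : nat) : (0 : R) \in `[0%R, 1%R] by rewrite in_itv /= lexx ler01.
(* The finite inequality is applied to the matrix W(v_i, v_j) of every sample and then integrated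
   over the samples. *)
have Sc : ((N.+1%:R ^+ k * c)%:E <= iter_int s S (fun=> 0%R))%E.
  rewrite -[leLHS](iter_cst s _ (fun=> 0%R)); apply: iter_le => // [|v _].
    by apply: gcst; rewrite mulr_ge0 // exprn_ge0.
  rewrite /S /F; under eq_bigr do rewrite sumEFin.
  rewrite sumEFin lee_fin.
  apply: le_trans (fin N (fun i j => W (v i) (v j)) _ _) _ => [i j|i j|]; first exact: symW.
    exact: W01.
  by apply: ler_sum => phi _; rewrite !big_cons big_nil addr0 !edge_weight_extend.
apply: (le_trans Sc); rewrite /S iter_sum // EF.
(* The terms of non-injective maps are bounded by 2, since each of the two products is at most 1. *)
apply: (@le_trans _ _ (\sum_(phi : {ffun 'I_k -> 'I_N.+1})
    if injectiveb phi then cube_integral k F else 2%:E)%E).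
  apply: lee_sum => phi _; case: ifP => [/injectiveP inj|_].
    rewrite (cube_sample (phi := extend phi) (k := k)) // => [i j ik jk|i ik].
      rewrite !inE in ik jk.
      rewrite (extend_ord phi (Ordinal ik)) (extend_ord phi (Ordinal jk)).
      by move/val_inj/inj => [].
    by rewrite (extend_ord phi (Ordinal ik)).
  rewrite -[leRHS](iter_cst s _ (fun=> 0%R)); apply: iter_le => //; exact: gcst.
rewrite (bigID (fun phi : {ffun 'I_k -> 'I_N.+1} => injectiveb phi)) /=.
rewrite (eq_bigr (fun=> cube_integral k F)); last by move=> phi ->.
rewrite [X in (_ + X)%E](eq_bigr (fun=> 2%:E)); last by move=> phi /negbTE ->.
have cI : #|[pred phi : {ffun 'I_k -> 'I_N.+1} | injectiveb phi]| = (N.+1 ^_ k)%N.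
  by rewrite -[k in RHS]card_ord -[N.+1 in RHS]card_ord -card_inj_ffuns cardsE.
have cN : #|[pred phi : {ffun 'I_k -> 'I_N.+1} | ~~ injectiveb phi]| = (N.+1 ^ k - N.+1 ^_ k)%N.
  have := cardC [pred phi : {ffun 'I_k -> 'I_N.+1} | injectiveb phi].
  by rewrite cI card_ffun !card_ord => <-; rewrite addKn.
by rewrite !big_const cI cN !iter_adde EFinM.
Qed.

(** If the density were m < c, the sampling bound for n points would give n (c - m) <= 2 k^2, which
    fails for large n. *)
Lemma finite_common_density (c : R) W : 0 <= c -> finite_common c -> is_graphon W ->
  (c%:E <= mono_density B W)%E.
Proof.
move=> c0 fin gW; have H N := mono_density_sample N c0 fin gW.
have M0 : (0 <= mono_density B W)%E.
  by rewrite -mono_density_restrict; have [_ _ W01] := graphon_restrict gW;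
    apply: adde_ge0; apply: cube_integral_ge0 => v; rewrite lee_fin prodr_ge0 // => p _;
    have := W01 (v p.1) (v p.2); lra.
case: (mono_density B W) M0 H => [m| |] // m0 H; last exact: leey.
rewrite lee_fin leNgt; apply/negP => mc; rewrite lee_fin in m0.
have := archi_boundP (x := 2 * (k ^ 2)%:R / (c - m)); set N := Num.bound _ => /(_ _) bN.
have {}bN : 2 * (k ^ 2)%:R < N.+1%:R * (c - m).
  rewrite -ltr_pdivrMr ?subr_gt0 //; apply: lt_le_trans (bN _) _; last by rewrite ler_nat.
  by rewrite divr_ge0 ?mulr_ge0 // subr_ge0 ltW.
have := H N; rewrite -EFinM -EFinD lee_fin natrB ?ffact_leq_expn // natrX.
have := expn_ffact_gap N.+1 k; rewrite -(ler_nat R) natrD !natrM !natrX.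
have : (N.+1 ^_ k)%:R <= N.+1%:R ^+ k :> R by rewrite -natrX ler_nat ffact_leq_expn.
have : 0 < N.+1%:R ^+ k :> R by rewrite exprn_gt0.
have : 0 < N.+1%:R :> R by [].
move: (N.+1%:R : R) bN (_ ^+ k) ((_ ^_ k)%:R : R) => n bN p q n0 p0 qp.
rewrite natrX expr2 in bN; move: (k%:R * k%:R : R) bN => K bN gap le.
have : n * (p * c) <= n * (q * m + (p - q) * 2) by rewrite ler_pM2l.
move=> le'.
have h1 : 0 <= (p - q) * m * n by rewrite !mulr_ge0 ?subr_ge0 // ltW.
have h2 : (2 * K) * p < (n * (c - m)) * p by rewrite ltr_pM2r.
have h3 : n * (q * m + (p - q) * 2) = n * p * m - (p - q) * m * n + 2 * (n * p - n * q) by ring.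
have h4 : n * (c - m) * p = n * (p * c) - n * p * m by ring.
rewrite h3 in le'; rewrite h4 in h2.
clear le; set x := n * p * m in h2 le'.
set y := (p - q) * m * n in h1 le' *; set z := n * (p * c) in h2 le'.
lra.
Qed.

End Sampling.

(** * The graphs H^{+a} *)

Definition nat_rel k (B : rel 'I_k) (i j : nat) : bool :=
  if insub i is Some x then (if insub j is Some y then B x y else false) else false.

Lemma nat_rel_ord k (B : rel 'I_k) (i j : 'I_k) : nat_rel B i j = B i j.
Proof. by rewrite /nat_rel !valK. Qed.

Lemma nat_rel_plus n a (adj : rel 'I_n) i j : (i < j < n + a)%N ->
  nat_rel (plus_graph (a := a) adj) i j = if (j < n)%N then nat_rel adj i j else (i < n)%N.
Proof.
case/andP=> ij jk; have ik := ltn_trans ij jk.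
rewrite (nat_rel_ord _ (Ordinal ik) (Ordinal jk)) /plus_graph.
case: fintype.splitP => i' /= Ei; case: fintype.splitP => j' /= Ej.
- by rewrite Ei Ej ltn_ord nat_rel_ord.
- by rewrite Ei Ej ltnNge leq_addr ltn_ord.
- by exfalso; have := ltn_ord j'; lia.
- by rewrite Ei Ej !ltnNge !leq_addr.
Qed.

Lemma uniq_pairs n : uniq (pairs n).
Proof.
elim: n => // n IH; rewrite pairsS cat_uniq IH map_inj_uniq ?iota_uniq ?andbT => [|i j [] //].
by apply/hasPn => _ /mapP[i _ ->]; rewrite mem_pairs ltnn andbF.
Qed.

Lemma edge_prod (R : comRingType) k (B : rel 'I_k) (g : nat -> nat -> R) :
  \prod_(p : 'I_k * 'I_k | is_edge B p) g p.1 p.2 =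
  \prod_(e <- pairs k) (if nat_rel B e.1 e.2 then g e.1 e.2 else 1).
Proof.
rewrite /is_edge big_mkcondr /= -big_filter.
pose f (p : 'I_k * 'I_k) : nat * nat := (nat_of_ord p.1, nat_of_ord p.2).
pose s := [seq p : 'I_k * 'I_k <- index_enum _ | (p.1 < p.2)%N].
rewrite [RHS](perm_big [seq f p | p <- s]) /=; last first.
  apply: uniq_perm; first exact: uniq_pairs.
    rewrite map_inj_uniq ?filter_uniq ?index_enum_uniq // => -[i j] [i' j'].
    by rewrite /f /= => -[/val_inj -> /val_inj ->].
  move=> [i j]; rewrite mem_pairs; apply/andP/mapP => [[ij jk]|[[i' j']]].
    exists (Ordinal (ltn_trans ij jk), Ordinal jk) => //.
    by rewrite mem_filter /= ij mem_index_enum.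
  by rewrite mem_filter => /andP[/= ij _] [-> ->].
by rewrite big_map; apply: eq_bigr => p _; rewrite /f /= nat_rel_ord.
Qed.

(** By induction on a: the pairs whose larger element is the newest vertex come last, and exactly
    those with smaller element in H are edges. *)
Lemma plus_edge_prod (R : comRingType) n a (adj : rel 'I_n) (g : nat -> nat -> R) :
  \prod_(p : 'I_(n + a) * 'I_(n + a) | is_edge (plus_graph (a := a) adj) p) g p.1 p.2 =
  (\prod_(e <- pairs n) (if nat_rel adj e.1 e.2 then g e.1 e.2 else 1)) *
  \prod_(j < a) \prod_(i <- iota 0 n) g i (n + j)%N.
Proof.
rewrite edge_prod.
pose b i j := if (j < n)%N then nat_rel adj i j else (i < n)%N.
transitivity (\prod_(e <- pairs (n + a)) (if b e.1 e.2 then g e.1 e.2 else 1)).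
  by apply: eq_big_seq => -[i j]; rewrite mem_pairs => /nat_rel_plus ->.
elim: a => [|a IH].
  rewrite addn0 big_ord0 mulr1; apply: eq_big_seq => -[i j]; rewrite mem_pairs.
  by case/andP=> _ jn; rewrite /b /= jn.
rewrite addnS pairsS big_cat IH big_ord_recr /= mulrA; congr (_ * _).
rewrite big_map iotaD big_cat /= [X in _ * X]big1_seq ?mulr1 => [|i]; last first.
  by rewrite mem_iota /b add0n => /andP[_ /andP[ni _]]; rewrite ltnNge leq_addr /= ltnNge ni.
by apply: eq_big_seq => i; rewrite mem_iota /b /= add0n => ->; rewrite ltnNge leq_addr.
Qed.

Lemma edge_prodZ (R : comRingType) k (B : rel 'I_k) (c : R) (g : 'I_k -> 'I_k -> R) :
  \prod_(p : 'I_k * 'I_k | is_edge B p) (c * g p.1 p.2) =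
  c ^+ nedges B * \prod_(p : 'I_k * 'I_k | is_edge B p) g p.1 p.2.
Proof.
rewrite big_split prodr_const; congr (_ ^+ _ * _); apply: eq_card => p.
by apply/idP/idP; rewrite in_setE.
Qed.

Lemma zip_map_self (S T : Type) (f : S -> T) s : zip s (map f s) = [seq (x, f x) | x <- s].
Proof. by elim: s => //= x s ->. Qed.

Lemma size_all_bits n b : b \in all_bits n -> size b = n.
Proof.
elim: n b => [|n IH] b /=; first by rewrite inE => /eqP ->.
by rewrite mem_cat => /orP[] /mapP[c /IH <- ->].
Qed.

Section Masks.
Variables (n : nat) (adj : rel 'I_n).
Let h := [seq nat_rel adj e.1 e.2 | e <- pairs n].

Lemma bipartite_maskP : bipartite adj -> bipartite_mask n h.
Proof.
case=> c cP; rewrite /bipartite_mask lazy_hasE zip_map_self.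
apply/hasP; exists [seq c i | i <- enum 'I_n].
  by rewrite -[X in all_bits X](size_enum_ord n) -(size_map c); exact: mem_all_bits.
apply/allP => _ /mapP[[i j] + ->]; rewrite mem_pairs => /andP[ij jn] /=.
have i_n := ltn_trans ij jn.
rewrite (nat_rel_ord _ (Ordinal i_n) (Ordinal jn)); apply/implyP => /cP.
have nthE (x : 'I_n) : nth false [seq c i | i <- enum 'I_n] x = c x.
  by rewrite (nth_map x) ?size_enum_ord // nth_ord_enum.
by rewrite /crosses (nthE (Ordinal i_n)) (nthE (Ordinal jn)).
Qed.

(** The colour class of a cut that no edge crosses is closed under adjacency, so connectedness makes
    the colouring constant. *)
Lemma connected_maskP : simple_graph adj -> graph_connected adj -> connected_mask n h.
Proof.
case=> sym irr conn; apply/allP => c /size_all_bits sc.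
case: eqP => // cF; case: eqP => // cT; rewrite lazy_hasE zip_map_self; apply: contraT => /hasPn nx.
have same : forall i j : 'I_n, (i < j)%N -> adj i j -> nth false c i = nth false c j.
  move=> i j ij e; have /nx : ((nat_of_ord i, nat_of_ord j), true) \in
      [seq (e, nat_rel adj e.1 e.2) | e <- pairs n].
    by apply/mapP; exists (nat_of_ord i, nat_of_ord j); rewrite ?mem_pairs ?ij ?ltn_ord ?nat_rel_ord ?e.
  by rewrite /crosses /= negbK => /eqP.
have cl : fingraph.closed adj [pred i : 'I_n | nth false c i].
  move=> i j e; rewrite !inE; case: (ltngtP i j) => ij; first exact: same.
    by apply/esym/same => //; rewrite sym.
  by rewrite (val_inj ij).
have eqc (i j : 'I_n) : nth false c i = nth false c j by have := closed_connect cl (conn i j); rewrite !inE.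
have [n0|n0] := posnP n; first by case: cF; rewrite n0; apply: size0nil; rewrite sc.
have cE b : nth false c (Ordinal n0) = b -> c = nseq n b.
  move=> E; apply: (@eq_from_nth _ false); rewrite ?size_nseq // sc => i lin.
  by rewrite nth_nseq lin -E -(eqc (Ordinal lin)).
by case E: (nth false c (Ordinal n0)); [case: cT | case: cF]; exact: cE.
Qed.

End Masks.

(** With u = 2w - 1, the factors 1 + u and 1 - u are twice w and 1 - w; one 2 for each edge produces
    the denominator of the bound. *)
Lemma finite_common_plus (R : realType) n (adj : rel 'I_n) a :
  simple_graph adj -> graph_connected adj -> bipartite adj -> (n <= 5)%N -> (0 < a)%N ->
  finite_common (plus_graph (a := a) adj) (2 / 2 ^+ nedges (plus_graph (a := a) adj) : R).
Proof.
move=> simple conn bip n5 a0 N w symw w01; set B := plus_graph adj.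
pose u i j := 2 * w i j - 1.
(* Stated for an arbitrary pair because it is used for both (u, w) and (-u, 1 - w). *)
have cs (u' : 'I_N.+1 -> 'I_N.+1 -> R) (w' : 'I_N.+1 -> 'I_N.+1 -> R) :
    (forall i j, 1 + u' i j = 2 * w' i j) ->
    cone_sum ord0 n a (nat_rel adj) u' = 2 ^+ nedges B *
      \sum_(phi : {ffun 'I_(n + a) -> 'I_N.+1})
        \prod_(p : 'I_(n + a) * 'I_(n + a) | is_edge B p) w' (phi p.1) (phi p.2).
  move=> E; rewrite mulr_sumr; apply: eq_bigr => phi _.
  rewrite -(edge_prodZ B 2 (fun i j => w' (phi i) (phi j))).
  transitivity (\prod_(p : 'I_(n + a) * 'I_(n + a) | is_edge B p)
      (1 + u' (env ord0 phi p.1) (env ord0 phi p.2))).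
    by rewrite (plus_edge_prod a adj (fun i j => 1 + u' (env ord0 phi i) (env ord0 phi j))).
  by apply: eq_bigr => p _; rewrite !env_ord E.
have := finite_inequality ord0 (u := u) (a := a) _ _ n5 a0 (bipartite_maskP bip)
  (connected_maskP simple conn).
rewrite card_ord (cs _ w) => [|i j]; last by rewrite /u; lra.
rewrite (cs _ (fun i j => 1 - w i j)) => [|i j]; last by rewrite /u; lra.
rewrite -mulrDr -big_split /= => H.
rewrite mulrA ler_pdivrMr ?exprn_gt0 // [leRHS]mulrC; apply: H => i j.
  by rewrite /u symw.
by rewrite ler_norml /u; have := w01 i j; lra.
Qed.

Theorem theorem1p4 (R : realType) (n : nat) (adj : rel 'I_n) (a : nat) :
  simple_graph adj -> graph_connected adj -> bipartite adj -> (n <= 5)%N ->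
  (0 < a)%N ->
  common R (@plus_graph n a adj).
Proof.
move=> simple conn bip n5 a0 W gW.
apply: finite_common_density => //.
exact: finite_common_plus.
Qed.
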